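(* Assume: (a) $G_C=G$ does not depend on $C\in\Theta^2$; (b) $\mathbf X$ is finite and $\mathsf P_G(X_t=x)>0$ for all $x$; (c) $0<I(\theta,\vartheta\mid x)<\infty$ for all $\theta\ne\vartheta$ in $\Theta$ and all $x$. Let $\{\phi_\tau\}$ be any uniformly good rule and let $C_0=(\theta_1,\theta_2)$ be a configuration that is not implicitly revealing, with arm 2 preferred for every $x$ (so $T_{inf}(t)=T_1(t)$). Define $$K_{C_0}=\inf_{\{\theta\in\Theta:\ \exists x_0\in\mathbf X,\ \mu_\theta(x_0)>\mu_{\theta_2}(x_0)\}}\ \sup_{x\in\mathbf X}I(\theta_1,\theta\mid x).$$ Then for every $\epsilon>0$, $$\lim_{t\to\infty}\mathsf P_{C_0}\Big(T_{inf}(t)\ge\frac{(1-\epsilon)\log t}{K_{C_0}}\Big)=1,\qquad \liminf_{t\to\infty}\frac{\mathsf E_{C_0}\{T_{inf}(t)\}}{\log t}\ge\frac1{K_{C_0}}.$$ The symmetric statement holds when arm 1 is preferred for every $x$.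
   Context: Two-armed bandit with side observations. $\Theta\subset\mathbb R$ is a parameter set and $\mathbf X\subset\mathbb R$. Known conditional distributions $\{F_\theta(dy\mid x)\}_{\theta\in\Theta}$ on $\mathbb R$ and a known law $G$ on $\mathbf X$. Under configuration $C_0=(\theta_1,\theta_2)\in\Theta^2$, $X_1,X_2,\dots$ are i.i.d. with law $G$, and for each arm $i$ the pairs $(X_t,Y^i_t)$ are i.i.d. with joint law $G(dx)F_{\theta_i}(dy\mid x)$. An allocation rule is $\phi_t\in\{1,2\}$ depending only on $X_1,\dots,X_t$ and previously observed rewards $Y^{\phi_\tau}_\tau$, $\tau<t$. $\mu_\theta(x)=\int yF_\theta(dy\mid x)$ (finite); $M_C(x)=\arg\max_i\mu_{i(C)}(x)$ with $1(C)=\theta_1,2(C)=\theta_2$. A configuration $C$ is implicitly revealing if there exist $x_1,x_2\in\mathbf X$ with $M_C(x_1)=1$ and $M_C(x_2)=2$; otherwise the preferred arm $M_C(x)$ is the same for all $x$. $T_i(t)=\sum_{\tau\le t}1\{\phi_\tau=i\}$, $T_{inf}(t)=\sum_{\tau\le t}1\{\phi_\tau\ne M_{C_0}(X_\tau)\}$. $I(\theta,\vartheta\mid x)$ is the Kullback–Leibler number between $F_\theta(\cdot\mid x)$ and $F_\vartheta(\cdot\mid x)$. A rule is uniformly good if for all $C$ and all $\alpha>0$, $\mathsf E_C\{T_{inf}(t)\}=o(t^\alpha)$. Conventions: $\inf\emptyset=\infty$, $1/\infty=0$.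
   Formalization: The probability limit is stated under the extra hypothesis K_{C0} > 0, since (1−ε) log t / K_{C0} is undefined when K_{C0} = 0; the bound on the expectation is stated for all K_{C0}, with 1/0 = ∞. *)

(* Defs.v *)
From HB Require Import structures.
From mathcomp Require Import all_boot all_order all_algebra.
From mathcomp Require Import all_classical all_reals all_analysis.
Set Implicit Arguments. Unset Strict Implicit. Unset Printing Implicit Defensive.
Import Order.TTheory GRing.Theory Num.Theory.
Import numFieldNormedType.Exports.
Local Open Scope classical_set_scope.
Local Open Scope ring_scope.

Inductive arm := arm1 | arm2.

Definition other (a : arm) : arm := match a with arm1 => arm2 | arm2 => arm1 end.

Definition cfg_par {R : Type} (C : R * R) (a : arm) : R :=
  match a with arm1 => C.1 | arm2 => C.2 end.

Section defs.
Context {R : realType}.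

Definition KL {d} {T : measurableType d} (P Q : probability T R) : \bar R :=
  if pselect (P `<< Q) then
    (\int[P]_y (ln (fine (Radon_Nikodym (charge_of_finite_measure P) Q y)))%:E)%E
  else +oo%E.

Context {X : finType}.
(** conditional reward distributions F_theta(dy | x) *)
Variable F : R -> X -> probability R R.

Definition mean (theta : R) (x : X) : R :=
  fine (\int[F theta x]_y (y%:E))%E.

Definition KLcond (theta vartheta : R) (x : X) : \bar R :=
  KL (F theta x) (F vartheta x).

Definition inferior (C : R * R) (x : X) (a : arm) : bool :=
  mean (cfg_par C a) x < mean (cfg_par C (other a)) x.

(** K_{C0} when arm [j] is preferred for every x *)
Definition K_const (Theta : set R) (C0 : R * R) (j : arm) : \bar R :=
  ereal_inf [set ereal_sup [set KLcond (cfg_par C0 (other j)) theta x | x in [set: X]]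
            | theta in [set theta | Theta theta /\
                 exists x0, mean (cfg_par C0 j) x0 < mean theta x0]].

(** Allocation rules: phi_t is a function of X_1..X_t and of the previously
    observed rewards (here times are 0,1,2,...; phi t sees X_0..X_t and the
    rewards observed at times 0..t-1). *)
Definition rule := forall t : nat, ('I_t.+1 -> X) -> ('I_t -> R) -> arm.

Definition cylinders (t : nat) : set (set ('I_t -> R)) :=
  [set S | exists (i : 'I_t) (B : set R), measurable B /\ S = [set ys | B (ys i)]].
Arguments cylinders : clear implicits.

Definition measurable_rule (phi : rule) : Prop :=
  forall t (xs : 'I_t.+1 -> X) (a : arm),
    smallest (sigma_algebra [set: 'I_t -> R]) (cylinders t) [set ys | phi t xs ys = a].

Context {Omega : Type}.
Variables (phi : rule) (Xs : nat -> Omega -> X) (Y : arm -> nat -> Omega -> R).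

Fixpoint obs (t : nat) (w : Omega) : seq R :=
  match t with
  | 0 => [::]
  | n.+1 => let h := obs n w in
      rcons h (Y (phi (fun i : 'I_n.+1 => Xs i w) (fun i : 'I_n => nth 0 h i)) n w)
  end.

Definition alloc (t : nat) (w : Omega) : arm :=
  phi (fun i : 'I_t.+1 => Xs i w) (fun i : 'I_t => nth 0 (obs t w) i).

Definition Tinf (C : R * R) (t : nat) (w : Omega) : nat :=
  \sum_(s < t) (inferior C (Xs s w) (alloc s w) : nat).

End defs.

(** The probabilistic model: under configuration C, (X_t, Y^1_t, Y^2_t)_t is an
    i.i.d. sequence, X_t has law g on X, and (X_t, Y^a_t) has joint law
    g(dx) F_{a(C)}(dy | x). *)
Definition model {R : realType} {X : finType} (F : R -> X -> probability R R)
  (g : X -> R) {d} {Omega : measurableType d} (P : probability Omega R)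
  (C : R * R) (Xs : nat -> Omega -> X) (Y : arm -> nat -> Omega -> R) : Prop :=
  [/\ (forall t x, measurable [set w | Xs t w = x]),
      (forall a t, measurable_fun [set: Omega] (Y a t)),
      (forall (n : nat) (A : nat -> set X) (B1 B2 : nat -> set R),
         (forall t, measurable (B1 t) /\ measurable (B2 t)) ->
         P (\bigcap_(t in `I_n) [set w | A t (Xs t w) /\ B1 t (Y arm1 t w)
                                          /\ B2 t (Y arm2 t w)])
         = (\prod_(t < n) P [set w | A t (Xs 0%N w) /\ B1 t (Y arm1 0%N w)
                                      /\ B2 t (Y arm2 0%N w)])%E) &
      (forall a x (B : set R), measurable B ->
         P [set w | Xs 0%N w = x /\ B (Y a 0%N w)] = ((g x)%:E * F (cfg_par C a) x B)%E)].

(* Main.v *)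
(** Lai-Robbins change of measure.  Let [i] be the inferior arm and let [theta] be
    a parameter that would make arm [i] strictly better at some context [x0].
    Write [L_t] for the log-likelihood ratio, accumulated over the pulls of arm
    [i], between the given configuration [C0] and the one [C'] where arm [i] has
    parameter [theta].  Under [C'], a uniformly good rule must pull arm [i] in most
    of the rounds with context [x0], which have positive frequency; hence few pulls
    of [i] have [C']-probability [o(t^(alpha - 1))] by Markov's inequality.  On
    [L_t <= (1 - eps/2) log t] this transfers to [C0] at a cost [t^(1 - eps/2)].
    The event that [L_t] is larger while arm [i] is pulled less than
    [(1 - eps) log t / k] times, where [k] bounds the divergences, is negligible:
    each pull increases [L_t] by at most [k] in conditional mean, whatever the
    context at which the rule decides to pull.  The law of the observed history
    only depends on the marginal laws of the two arms, so the change of measure is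
    carried out along each fixed sequence of contexts and pulled arms. *)

(* Two obstacles shape the proof. [model] leaves the coupling of the two rewards of a round free,
   and it may vary with the configuration, so a likelihood ratio on the full past need not exist.
   Once contexts and pulled arms are frozen, one reward per round is read and only marginals enter;
   finiteness of [X] makes these paths finitely many. Secondly, a finite divergence gives an
   integrable log-likelihood ratio and nothing more: no variance, no exponential moment. The ratio
   is truncated at a level common to all contexts; the bounded part is handled by an exponential
   moment, the tail only through its mean. Since [t] is exponentially larger than the number [N] of
   pulls, both bounds must depend on [N] alone. The exponents fit because
   [(1 - eps) * (1 + eps/2) <= 1 - eps/2]: the slack [eps/2] in the divergence pays for the
   fluctuations, and the factor [t^(- eps/2)] left after the transfer is what uniform goodness with
   [alpha = eps/2] absorbs. That [x0] is frequent is made part of the transferred event, so its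
   failure is estimated under [C0]. *)
Require Import Defs.
From HB Require Import structures.
From mathcomp Require Import all_boot all_order all_algebra.
From mathcomp Require Import all_classical all_reals all_analysis.
From mathcomp Require Import measurable_realfun.
From mathcomp Require Import zify ring lra.
Import Order.TTheory GRing.Theory Num.Theory.
Import numFieldNormedType.Exports.
Local Open Scope classical_set_scope.
Local Open Scope ring_scope.
Set Implicit Arguments. Unset Strict Implicit. Unset Printing Implicit Defensive.

(** * Sub-sigma-algebras *)

Section sub_sigma_algebra.
Context {R : realType} {d : measure_display} {T : measurableType d}.
Implicit Type G : set (set T).

Lemma finite_measure_unique_generated G (m1 m2 : {measure set T -> \bar R}) :
  G `<=` measurable -> G setT -> setI_closed G -> (m1 setT < +oo)%E ->
  (forall A, G A -> m1 A = m2 A) ->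
  forall E, <<s G >> E -> m1 E = m2 E.
Proof.
move=> Gm GT GI m1oo m12.
apply: (g_sigma_algebra_measure_unique G Gm (fun=> setT)) => //.
by rewrite bigcup_const//; exists 0%N.
Qed.

Lemma generated_measurable G : G `<=` measurable -> <<s G >> `<=` measurable.
Proof. by move=> Gm; apply: smallest_sub => //; exact: sigma_algebra_measurable. Qed.

Lemma measurable_fun_generated G d' (T' : measurableType d') (f : T -> T') :
  G `<=` measurable ->
  measurable_fun [set: g_sigma_algebraType G] f -> measurable_fun [set: T] f.
Proof.
move=> Gm mf _ B mB; apply: (generated_measurable Gm).
exact: (mf measurableT).
Qed.

(** The proofs [f0] and [mf] are arguments so that the measure structure declared below can be
    inferred from the term alone. *)
Definition density (mu : {measure set T -> \bar R}) (f : T -> R)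
  (f0 : forall x, 0 <= f x) (mf : measurable_fun setT f) (A : set T) : \bar R :=
  (\int[mu]_(x in A) (f x)%:E)%E.

Section density_measure.
Variables (mu : {measure set T -> \bar R}) (f : T -> R).
Variables (f0 : forall x, 0 <= f x) (mf : measurable_fun setT f).

Let density0 : density mu f0 mf set0 = 0%E.
Proof. exact: integral_set0. Qed.

Let density_ge0 A : (0 <= density mu f0 mf A)%E.
Proof. by apply: integral_ge0 => x _; rewrite lee_fin. Qed.

Let density_sigma_additive : semi_sigma_additive (density mu f0 mf).
Proof.
move=> A mA tA mUA; rewrite /density ge0_integral_bigcup//; last 2 first.
- by apply/measurable_EFinP; exact: measurable_funS mf.
- by move=> x _; rewrite lee_fin.
apply: is_cvg_ereal_nneg_natsum => n _.
by apply: integral_ge0 => x _; rewrite lee_fin.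
Qed.

HB.instance Definition _ := isMeasure.Build _ _ _ (density mu f0 mf)
  density0 density_ge0 density_sigma_additive.

End density_measure.

Lemma ge0_integral_mrestr (mu : {measure set T -> \bar R}) (U : set T)
    (mU : measurable U) (f : T -> \bar R) :
  measurable_fun setT f -> (forall x, 0 <= f x)%E ->
  (\int[mrestr mu mU]_x f x = \int[mu]_(x in U) f x)%E.
Proof.
move=> mf f0; rewrite -(setvU U) ge0_integral_setU//; last 3 first.
- exact: measurableC.
- by rewrite setvU.
- by apply/disj_setPS => x [].
rewrite (@eq_measure_integral _ _ _ (~` U) mzero); last first.
  move=> A mA AU; rewrite /= /mrestr /mzero (_ : A `&` U = set0) ?measure0//.
  by apply/seteqP; split => x // [/AU].
rewrite integral_measure_zero add0e.
by apply: eq_measure_integral => A mA AU; rewrite /= /mrestr setIidl.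
Qed.

(** Hypothesis [ind] says on rectangles that, restricted to [U], the map [x |-> (x, V x)] has as law
    the product of [P] on [<<s G>>] and [c * Q]. Uniqueness of the product measure extends this to
    all events, and Tonelli separates the integrals. *)
Lemma ge0_integral_tensor G (P : probability T R) (U : set T) (V : T -> R)
    (c : R) (Q : probability R R) (W : T -> R) (w : R -> R) :
  G `<=` measurable -> measurable U -> measurable_fun setT V -> 0 <= c ->
  (forall E B, <<s G >> E -> measurable B ->
     P (E `&` (U `&` V @^-1` B)) = (P E * (c%:E * Q B))%E) ->
  measurable_fun [set: g_sigma_algebraType G] W -> (forall x, 0 <= W x) ->
  measurable_fun setT w -> (forall y, 0 <= w y) ->
  (\int[P]_(x in U) (W x * w (V x))%:E =
   (\int[P]_x (W x)%:E) * (c%:E * \int[Q]_y (w y)%:E))%E.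
Proof.
move=> Gm mU mV c0 ind mW W0 mw w0.
pose TG : measurableType _ := g_sigma_algebraType G.
have mid : measurable_fun [set: T] (id : T -> TG).
  by move=> _ B mB; rewrite setTI; exact: generated_measurable mB.
(* The identity onto the same set with fewer events: its distribution is [P] restricted to
   [<<s G>>]. *)
pose idf : {mfun T >-> TG} :=
  HB.pack (id : T -> TG) (isMeasurableFun.Build _ _ _ _ _ mid).
pose PG : probability TG R := distribution P idf.
pose cQ : {finite_measure set R -> \bar R} := mscale (NngNum c0) Q.
pose J (x : T) : TG * R := (x, V x).
have mJ : measurable_fun setT J by apply: measurable_fun_pair.
pose PJ' : {measure set (TG * R) -> \bar R} :=
  pushforward (mrestr P mU) J.
pose PJ := PJ' mJ.
pose f (z : TG * R) : \bar R := (W z.1 * w z.2)%:E.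
have mf : measurable_fun setT f.
  apply/measurable_EFinP; apply: measurable_funM.
    exact: measurableT_comp mW measurable_fst.
  exact: measurableT_comp mw measurable_snd.
have f0 z : (0 <= f z)%E by rewrite lee_fin mulr_ge0.
have PJE S : measurable S -> (PG \x cQ)%E S = PJ S.
  apply: product_measure_unique => A B mA mB.
  rewrite /PJ /PG /distribution /= /pushforward /mrestr /mscale /=.
  rewrite -ind//; congr (P _).
  by apply/seteqP; split => z /=; [move=> [[]]|move=> [? []]].
transitivity (\int[PJ]_z f z)%E.
  rewrite ge0_integral_pushforward//= preimage_setT ge0_integral_mrestr//.
  exact/measurableT_comp.
rewrite -(eq_measure_integral _ (fun S mS _ => PJE S mS)).
rewrite fubini_tonelli1//= /fubini_F /f /=.
under eq_integral => x _.
  under eq_integral do rewrite EFinM.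
  rewrite ge0_integralZl//; last 3 first.
  - exact/measurable_EFinP.
  - by move=> y _; rewrite lee_fin.
  - by rewrite lee_fin.
  rewrite ge0_integral_mscale//; last 2 first.
  - exact/measurable_EFinP.
  - by move=> y _; rewrite lee_fin.
  over.
rewrite ge0_integralZr//=; last 3 first.
- exact/measurable_EFinP.
- by move=> y _; rewrite lee_fin.
- by apply: mule_ge0; rewrite ?lee_fin//; apply: integral_ge0 => y _; rewrite lee_fin.
congr (_ * _)%E.
rewrite ge0_integral_pushforward//=; first exact/measurable_EFinP.
by move=> y _; rewrite lee_fin.
Qed.

End sub_sigma_algebra.

(** * The observed history is adapted to the past *)

Section rule_measurability.
Context {R : realType} {X : finType} {d : measure_display} {T : measurableType d}.

(** [measurable_rule] speaks of one fixed context sequence at a time; since [X] is finite, the event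
    is cut along the finitely many sequences. *)
Lemma measurable_rule_comp (phi : @rule R X) t (xs : 'I_t.+1 -> T -> X)
    (ys : 'I_t -> T -> R) (a : arm) :
  measurable_rule phi ->
  (forall i x, measurable [set w | xs i w = x]) ->
  (forall i, measurable_fun setT (ys i)) ->
  measurable [set w | phi t (fun i => xs i w) (fun i => ys i w) = a].
Proof.
move=> mphi mxs mys.
pose CT : measurableType _ := g_sigma_algebraType (@cylinders R t).
have my : measurable_fun setT ((fun w i => ys i w) : T -> CT).
  apply: (@measurability _ _ T CT setT _ (@cylinders R t)) => //.
  move=> _ [_ [i [B [mB ->]]] <-]; rewrite setTI.
  by rewrite -[X in measurable X]setTI; exact: mys.
rewrite (_ : [set _ | _] = \bigcup_(f in [set: {ffun 'I_t.+1 -> X}])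
    ((\bigcap_(i in [set: 'I_t.+1]) [set w | xs i w = f i]) `&`
     ((fun w i => ys i w) : T -> CT) @^-1` [set y | phi t f y = a])).
  apply: fin_bigcup_measurable => // f _; apply: measurableI.
    by apply: fin_bigcap_measurable => // i _.
  rewrite -[X in measurable X]setTI; apply: my => //.
  exact: (mphi t (fun i => f i) a).
apply/seteqP; split => [w /= wa|w [f _ [/= wf]]].
  exists [ffun i => xs i w] => //; split => /=; first by move=> i _ /=; rewrite ffunE.
  rewrite -wa; congr (phi t _ _).
  by apply/funext => i; rewrite ffunE.
move=> <-; congr (phi t _ _).
by apply/funext => i; rewrite wf.
Qed.

End rule_measurability.

Section past.
Context {R : realType} {X : finType} {d : measure_display} {Omega : measurableType d}.
Variables (Xs : nat -> Omega -> X) (Y : arm -> nat -> Omega -> R).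

(** The past keeps the rewards of both arms, observed or not: these are the rectangles on which
    [model] asserts independence, and they form a pi-system. *)
Definition past_rect (t : nat) : set (set Omega) :=
  [set E | exists A : nat -> set X, exists B1 B2 : nat -> set R,
     (forall s, measurable (B1 s) /\ measurable (B2 s)) /\
     E = \bigcap_(s in `I_t) [set w | A s (Xs s w) /\ B1 s (Y arm1 s w)
                                      /\ B2 s (Y arm2 s w)]].

Definition pastType t := g_sigma_algebraType (past_rect t).
HB.instance Definition _ t := Measurable.on (pastType t).

Lemma past_rectT t : past_rect t setT.
Proof.
exists (fun=> setT), (fun=> setT), (fun=> setT); split => //.
by apply/seteqP; split.
Qed.

Lemma past_rectI t : setI_closed (past_rect t).
Proof.
move=> _ _ [A [B1 [B2 [mB ->]]]] [A' [B1' [B2' [mB' ->]]]].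
exists (fun s => A s `&` A' s), (fun s => B1 s `&` B1' s), (fun s => B2 s `&` B2' s).
split.
  by move=> s; have [? ?] := mB s; have [? ?] := mB' s; split; apply: measurableI.
apply/seteqP; split => [w [] h h' s st|w h].
  by have [? [? ?]] := h s st; have [? [? ?]] := h' s st.
by split => s st; have [[? ?] [[? ?] [? ?]]] := h s st.
Qed.

Lemma past_rectW s t : (s <= t)%N -> past_rect s `<=` past_rect t.
Proof.
move=> st _ [A [B1 [B2 [mB ->]]]].
exists (fun r => if (r < s)%N then A r else setT).
exists (fun r => if (r < s)%N then B1 r else setT).
exists (fun r => if (r < s)%N then B2 r else setT); split.
  by move=> r; case: ifP.
apply/seteqP; split => w h r /= rs.
  by case: ifP => // rs'; exact: h.
by have := h r (leq_trans rs st); rewrite /= rs.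
Qed.

Lemma past_sigmaW s t : (s <= t)%N -> <<s past_rect s >> `<=` <<s past_rect t >>.
Proof. by move=> /past_rectW; exact: sub_smallest2r. Qed.

Lemma past_measurable_funW s t d' (T' : measurableType d') (f : Omega -> T') :
  (s <= t)%N -> measurable_fun [set: pastType s] f ->
  measurable_fun [set: pastType t] f.
Proof. by move=> st mf _ B mB; apply: (past_sigmaW st); exact: mf. Qed.

Lemma past_measurable_context s t x : (s < t)%N ->
  measurable ([set w | Xs s w = x] : set (pastType t)).
Proof.
move=> st; apply: sub_sigma_algebra.
exists (fun r => if r == s then [set x] else setT), (fun=> setT), (fun=> setT).
split => //; apply/seteqP; split => [w /= h r rt /=|w h].
  by split=> //; case: eqVneq => // ->.
by have [] := h s st; rewrite eqxx.
Qed.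

Lemma past_measurable_reward s t a : (s < t)%N ->
  measurable_fun [set: pastType t] (Y a s).
Proof.
move=> st _ B mB; rewrite setTI; apply: sub_sigma_algebra.
pose Bs (c : arm) b r := if r == s then (match c, b with
  arm1, true => B | arm2, false => B | _, _ => setT end) else setT.
exists (fun=> setT), (Bs a true), (Bs a false); split.
  by move=> r; rewrite /Bs; case: ifP => // _; case: a.
apply/seteqP; split => [w /= h r rt /=|w h].
  by split=> //; rewrite /Bs; case: eqVneq => // ->; case: a h.
by have := h s st; rewrite /= /Bs eqxx /=; case: a {h} => -[_ []].
Qed.

Variable phi : @rule R X.
Hypothesis mphi : measurable_rule phi.

(** The current context is replaced by a fixed [x], so that the decision becomes an event of the
    strict past. The dependence on the true context is restored by [alloc_atE]. *)
Definition alloc_at (t : nat) (x : X) (w : Omega) : arm :=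
  phi (fun i : 'I_t.+1 => if (i < t)%N then Xs i w else x)
      (fun i : 'I_t => nth 0 (obs phi Xs Y t w) i).

Lemma alloc_atE t w : alloc phi Xs Y t w = alloc_at t (Xs t w) w.
Proof.
rewrite /alloc /alloc_at; congr (phi _ _); apply/funext => i.
case: ifPn => //; rewrite -leqNgt => ti; congr (Xs _ _).
by apply/eqP; rewrite eqn_leq ti -ltnS ltn_ord.
Qed.

Lemma obsS t w : obs phi Xs Y t.+1 w =
  rcons (obs phi Xs Y t w) (Y (alloc phi Xs Y t w) t w).
Proof. by []. Qed.

Lemma size_obs t w : size (obs phi Xs Y t w) = t.
Proof. by elim: t => //= t IH; rewrite size_rcons IH. Qed.

Lemma nth_obs t s w : (s < t)%N ->
  nth 0 (obs phi Xs Y t w) s = Y (alloc phi Xs Y s w) s w.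
Proof.
elim: t => // t IH; rewrite ltnS leq_eqVlt => /orP[/eqP ->|st].
  by rewrite obsS nth_rcons size_obs ltnn eqxx.
by rewrite obsS nth_rcons size_obs st IH.
Qed.

(** Measurability of the history is a premise here and in the next lemma because both serve inside
    the induction that proves it. *)
Lemma past_measurable_alloc_at t x a :
  (forall i, measurable_fun [set: pastType t]
     (fun w => nth 0 (obs phi Xs Y t w) i)) ->
  measurable ([set w | alloc_at t x w = a] : set (pastType t)).
Proof.
move=> mobs; apply: (@measurable_rule_comp R X _ (pastType t) phi t
  (fun i w => if (i < t)%N then Xs i w else x)
  (fun i w => nth 0 (obs phi Xs Y t w) i)) => //.
move=> i x0; case: (boolP (i < t)%N) => it; first exact: past_measurable_context.
have [->|/eqP xx0] := eqVneq x x0.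
  by rewrite (_ : [set _ | _] = setT)//; apply/seteqP; split.
by rewrite (_ : [set _ | _] = set0)//; apply/seteqP; split.
Qed.

Lemma past_measurable_alloc_of_obs t a :
  (forall i, measurable_fun [set: pastType t]
     (fun w => nth 0 (obs phi Xs Y t w) i)) ->
  measurable ([set w | alloc phi Xs Y t w = a] : set (pastType t.+1)).
Proof.
move=> mobs; rewrite (_ : [set _ | _] = \bigcup_(x in [set: X])
  ([set w | Xs t w = x] `&` [set w | alloc_at t x w = a])).
  apply: fin_bigcup_measurable => // x _; apply: measurableI.
    exact: past_measurable_context.
  exact: (past_sigmaW (leqnSn t)) (past_measurable_alloc_at x a mobs).
apply/seteqP; split => [w /= <-|w [x _ [/= <- <-]]].
  by exists (Xs t w) => //=; split => //; rewrite alloc_atE.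
by rewrite alloc_atE.
Qed.

Lemma past_measurable_obs t i :
  measurable_fun [set: pastType t] (fun w => nth 0 (obs phi Xs Y t w) i).
Proof.
elim: t i => [|t IH] i.
  by under eq_fun do rewrite nth_nil; exact: measurable_cst.
under eq_fun do rewrite obsS nth_rcons size_obs.
have [it|ti] := ltnP i t; first exact: past_measurable_funW (IH i).
case: (eqVneq i t) => _; last exact: measurable_cst.
rewrite (_ : (fun w => _) = (fun w =>
    \1_[set w | alloc phi Xs Y t w = arm1] w * Y arm1 t w +
    \1_[set w | alloc phi Xs Y t w = arm2] w * Y arm2 t w)); last first.
  apply/funext => w; rewrite !indicE.
  case E : (alloc phi Xs Y t w).
    by rewrite mem_set// memNset ?mul1r ?mul0r ?addr0//= E.
  by rewrite memNset ?mem_set ?mul1r ?mul0r ?add0r//= E.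
have ma a : measurable_fun [set: pastType t.+1]
    (\1_[set w | alloc phi Xs Y t w = a] : Omega -> R).
  apply: (@measurable_indic _ (pastType t.+1)).
  exact: past_measurable_alloc_of_obs.
apply: (@measurable_funD _ (pastType t.+1)); apply: measurable_funM => //;
  exact: past_measurable_reward.
Qed.

Lemma past_measurable_alloc s t a : (s < t)%N ->
  measurable ([set w | alloc phi Xs Y s w = a] : set (pastType t)).
Proof.
move=> st; apply: (past_sigmaW st).
by apply: past_measurable_alloc_of_obs => i; exact: past_measurable_obs.
Qed.

End past.

(** * Integration against the new observation *)

Definition arm_eqb (a b : arm) : bool :=
  match a, b with arm1, arm1 => true | arm2, arm2 => true | _, _ => false end.

Lemma arm_eqP (a b : arm) : reflect (a = b) (arm_eqb a b).
Proof. by case: a; case: b; constructor. Qed.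

(** The sum is exactly the minimum of the final count and [N], a form that passes through the
    induction. *)
Lemma sum_lt_counter (b : nat -> bool) (N t : nat) :
  (\sum_(s < t) (b s && (\sum_(r < s) b r < N)%N) <= N)%N.
Proof.
suff -> : (\sum_(s < t) (b s && (\sum_(r < s) b r < N)%N) =
           minn (\sum_(s < t) b s) N)%N by exact: geq_minr.
elim: t => [|t IH]; first by rewrite !big_ord0 min0n.
rewrite !big_ord_recr /= IH; case: (b t) => /=; last by rewrite !addn0.
by set c := (\sum_(i < t) b i)%N; lia.
Qed.

Section finite_context.
Context {X : finType} {d : measure_display} {T : measurableType d}.

Lemma measurable_fun_context d' (T' : measurableType d') (xi : T -> X)
    (f : X -> T -> T') :
  (forall x, measurable [set w | xi w = x]) ->
  (forall x, measurable_fun setT (f x)) ->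
  measurable_fun setT (fun w => f (xi w) w).
Proof.
move=> mxi mf _ B mB; rewrite setTI.
rewrite (_ : _ @^-1` _ =
  \bigcup_(x in [set: X]) ([set w | xi w = x] `&` (setT `&` f x @^-1` B))).
  apply: fin_bigcup_measurable => // x _; apply: measurableI => //.
  exact: mf.
apply/seteqP; split => [w /= h|w [x _ [/= <- [_ ]]]//].
by exists (xi w).
Qed.

End finite_context.

Section model_integrals.
Context {R : realType} {X : finType} {d : measure_display} {Omega : measurableType d}.
Variables (F : R -> X -> probability R R) (g : X -> R) (P : probability Omega R).
Variables (C : R * R) (Xs : nat -> Omega -> X) (Y : arm -> nat -> Omega -> R).
Hypothesis mod : model F g P C Xs Y.
Hypothesis g0 : forall x, 0 < g x.

Lemma past_rect_measurable t : past_rect Xs Y t `<=` measurable.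
Proof.
have [mX mY _ _] := mod.
move=> _ [A [B1 [B2 [mB ->]]]]; apply: fin_bigcap_measurable => // s _.
have [mB1 mB2] := mB s.
apply: measurableI; last apply: measurableI.
- rewrite (_ : (fun _ => _) = \bigcup_(x in A s) [set w | Xs s w = x]).
    by apply: fin_bigcup_measurable => // ? _; exact: mX.
  by apply/seteqP; split => [w h|w [x Ax /= xw]]; [exists (Xs s w)|rewrite xw].
- by rewrite -[X in measurable X]setTI; exact: mY.
- by rewrite -[X in measurable X]setTI; exact: mY.
Qed.

(** Both sides are finite measures in [E], so it suffices to compare them on past rectangles, where
    the independence clause of [model] applies. *)
Lemma past_indep t E a x B : <<s past_rect Xs Y t >> E -> measurable B ->
  P (E `&` ([set w | Xs t w = x] `&` Y a t @^-1` B)) =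
  (P E * ((g x)%:E * F (cfg_par C a) x B))%E.
Proof.
move=> hE mB; have [mX mY mind mlaw] := mod.
have mV : measurable ([set w | Xs t w = x] `&` Y a t @^-1` B).
  by apply: measurableI => //; rewrite -[X in measurable X]setTI; exact: mY.
have gF0 : 0 <= g x * fine (F (cfg_par C a) x B) by rewrite mulr_ge0 ?fine_ge0// ltW.
have -> : ((g x)%:E * F (cfg_par C a) x B =
    (g x * fine (F (cfg_par C a) x B))%:E)%E.
  by rewrite EFinM fineK// fin_num_measure.
have := @finite_measure_unique_generated R _ Omega _ (mrestr P mV)
  (mscale (NngNum gF0) P) (@past_rect_measurable t) (past_rectT _ _ t)
  (@past_rectI _ _ _ _ Xs Y t) _ _ _ hE.
rewrite /= /mscale /mrestr /= muleC => -> //.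
  by rewrite (le_lt_trans (probability_le1 P _)) ?ltry//; exact: measurableI.
move=> _ [A [B1 [B2 [mBs ->]]]].
(* The rectangle is extended by one coordinate at time [t], with no constraint on the arm other than
   [a]: only the law of the pair formed by context and reward of [a] is then used. *)
pose A' s := if s == t then [set x] else A s.
pose B' (c : arm) b s : set R := if s == t then (match c, b with
  arm1, true => B | arm2, false => B | _, _ => setT end)
  else if b then B1 s else B2 s.
have mB' s : measurable (B' a true s) /\ measurable (B' a false s).
  by rewrite /B'; case: ifP => // _; case: a {mV gF0}.
rewrite (_ : _ `&` _ = \bigcap_(s in `I_t.+1) [set w | A' s (Xs s w) /\
    B' a true s (Y arm1 s w) /\ B' a false s (Y arm2 s w)]); last first.
  apply/seteqP; split => [w [h [hx hB]] s /=|w h].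
    rewrite ltnS leq_eqVlt /A' /B'; case: eqVneq => [->|_]/= st.
      by split=> //; case: a hB {mV gF0 mB'}.
    exact: h.
  split.
    move=> s /= st; have := h s (ltnW st); rewrite /= /A' /B'.
    by rewrite (ltn_eqF st).
  by have := h t (ltnSn t); rewrite /= /A' /B' eqxx; case: a {h mV gF0 mB'} => -[-> []].
rewrite (mind _ _ _ _ mBs) (mind _ _ _ _ mB') big_ord_recr /= muleC; congr (_ * _)%E.
  rewrite /A' /B' eqxx EFinM fineK ?fin_num_measure// -(mlaw a x B mB).
  by congr (P _); apply/seteqP; case: a {mV gF0 mB'}; split => w /= [] //; [move=> -> []|move=> -> []].
apply: eq_bigr => s _; congr (P _).
by rewrite /A' /B' (ltn_eqF (ltn_ord s)).
Qed.

(** [W] may depend on the current context, as the decision of the rule does. Cutting along its value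
    leaves, for each [x], a past factor times an independent factor. *)
Lemma integral_past_step t a (W : X -> Omega -> R) (w : X -> R -> R) :
  (forall x, measurable_fun [set: pastType Xs Y t] (W x)) ->
  (forall x o, 0 <= W x o) ->
  (forall x, measurable_fun setT (w x)) -> (forall x y, 0 <= w x y) ->
  (\int[P]_o (W (Xs t o) o * w (Xs t o) (Y a t o))%:E =
   \sum_(x in X) ((\int[P]_o (W x o)%:E) *
     ((g x)%:E * \int[F (cfg_par C a) x]_y (w x y)%:E)))%E.
Proof.
move=> mW W0 mw w0; have [mX mY _ _] := mod.
pose f x o := ((fun o => (W x o * w x (Y a t o))%:E) \_ [set o | Xs t o = x]) o.
transitivity (\int[P]_o (\sum_(x in X) f x o))%E.
  apply: eq_integral => o _; rewrite (bigD1 (Xs t o))//= big1 ?adde0.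
    by rewrite /f patchE mem_set.
  by move=> x xo; rewrite /f patchE memNset//= => /esym/eqP; exact/negP.
rewrite ge0_integral_sum//; last 2 first.
- move=> x; apply/(measurable_restrictT _ _).1 => //.
  apply: measurable_funTS; apply/measurable_EFinP; apply: measurable_funM.
    exact: measurable_fun_generated (@past_rect_measurable t) (mW x).
  exact: measurableT_comp.
- move=> x o _; rewrite /f patchE; case: ifP => // _.
  by rewrite lee_fin mulr_ge0.
apply: eq_big => // x _.
rewrite -integral_mkcond.
apply: (@ge0_integral_tensor _ _ _ (past_rect Xs Y t)) => //.
- exact: past_rect_measurable.
- exact: ltW.
- by move=> E B hE mB; exact: past_indep.
Qed.

Lemma integral_past_context t (W : X -> Omega -> R) :
  (forall x, measurable_fun [set: pastType Xs Y t] (W x)) ->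
  (forall x o, 0 <= W x o) ->
  (\int[P]_o (W (Xs t o) o)%:E =
   \sum_(x in X) ((\int[P]_o (W x o)%:E) * (g x)%:E))%E.
Proof.
move=> mW W0.
have := @integral_past_step t arm1 W (fun _ _ => 1) mW W0
  (fun=> measurable_cst _) (fun _ _ => ler01).
under eq_integral do rewrite mulr1.
move=> ->; apply: eq_bigr => x _.
by rewrite integral_cst//= probability_setT !mul1e mule1.
Qed.

(** This plays the part of conditioning on the past and the current context: a bound on the mean
    valid at every context survives any choice made by the rule. *)
Lemma integral_past_step_le t a (W : X -> Omega -> R) (w : X -> R -> R) (c : R) :
  (forall x, measurable_fun [set: pastType Xs Y t] (W x)) ->
  (forall x o, 0 <= W x o) ->
  (forall x, measurable_fun setT (w x)) -> (forall x y, 0 <= w x y) ->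
  (forall x, \int[F (cfg_par C a) x]_y (w x y)%:E <= c%:E)%E ->
  (\int[P]_o (W (Xs t o) o * w (Xs t o) (Y a t o))%:E <=
   c%:E * \int[P]_o (W (Xs t o) o)%:E)%E.
Proof.
move=> mW W0 mw w0 wc; rewrite integral_past_step// integral_past_context//.
rewrite ge0_sume_distrr; last first.
  move=> x _; rewrite mule_ge0// ?lee_fin; last exact: ltW.
  by apply: integral_ge0 => o _; rewrite lee_fin.
apply: lee_sum => x _; rewrite [leRHS]muleC -muleA.
apply: lee_wpmul2l; first by apply: integral_ge0 => o _; rewrite lee_fin.
by apply: lee_wpmul2l; rewrite ?lee_fin// ltW.
Qed.

End model_integrals.

(** * Sums and products over the pulls of one arm *)

Section adapted.
Context {R : realType} {X : finType} {d : measure_display} {Omega : measurableType d}.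
Variables (Xs : nat -> Omega -> X) (Y : arm -> nat -> Omega -> R).
Variable phi : @rule R X.
Hypothesis mphi : measurable_rule phi.
Local Notation alloc := (alloc phi Xs Y).

Definition pulls (a : arm) (t : nat) (o : Omega) : nat :=
  \sum_(s < t) arm_eqb (alloc s o) a.

Lemma past_measurable_alloc_eqb s t a : (s < t)%N ->
  measurable_fun [set: pastType Xs Y t] (fun o => arm_eqb (alloc s o) a).
Proof.
move=> st; apply: (measurable_fun_bool true); rewrite setTI.
rewrite (_ : _ @^-1` _ = [set o | alloc s o = a]).
  exact: past_measurable_alloc.
by apply/seteqP; split => o /= /arm_eqP.
Qed.

Lemma past_measurable_alloc_at_eqb t x a :
  measurable_fun [set: pastType Xs Y t] (fun o => arm_eqb (alloc_at Xs Y phi t x o) a).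
Proof.
apply: (measurable_fun_bool true); rewrite setTI.
rewrite (_ : _ @^-1` _ = [set o | alloc_at Xs Y phi t x o = a]).
  by apply: past_measurable_alloc_at => // i; exact: past_measurable_obs.
by apply/seteqP; split => o /= /arm_eqP.
Qed.

Lemma measurable_fun_nat_bool d' (T : measurableType d') (b : T -> bool) :
  measurable_fun setT b -> measurable_fun setT (fun o => (b o)%:R : R).
Proof.
move=> mb; rewrite (_ : (fun _ => _) = (fun o => if b o then 1 else 0 : R)).
  exact: measurable_fun_ifT.
by apply/funext => o; case: (b o).
Qed.

Lemma past_measurable_pulls a t :
  measurable_fun [set: pastType Xs Y t] (fun o => (pulls a t o)%:R : R).
Proof.
under eq_fun do rewrite /pulls natr_sum.
apply: measurable_sum => s; apply: measurable_fun_nat_bool.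
exact: past_measurable_alloc_eqb.
Qed.

Lemma past_measurable_observation s t a (w : X -> R -> R) : (s < t)%N ->
  (forall x, measurable_fun setT (w x)) ->
  measurable_fun [set: pastType Xs Y t] (fun o => w (Xs s o) (Y a s o)).
Proof.
move=> st mw; apply: (@measurable_fun_context X _ (pastType Xs Y t) _ _
  (Xs s) (fun x o => w x (Y a s o))) => x.
  exact: past_measurable_context.
by apply: measurableT_comp => //; exact: past_measurable_reward.
Qed.

Definition pull_prod (w : X -> R -> R) (a : arm) (t : nat) (o : Omega) : R :=
  \prod_(s < t) (if arm_eqb (alloc s o) a then w (Xs s o) (Y a s o) else 1).

Definition pull_sum (w : X -> R -> R) (a : arm) (t : nat) (o : Omega) : R :=
  \sum_(s < t) (if arm_eqb (alloc s o) a then w (Xs s o) (Y a s o) else 0).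

Lemma past_measurable_pull_prod w a t :
  (forall x, measurable_fun setT (w x)) ->
  measurable_fun [set: pastType Xs Y t] (pull_prod w a t).
Proof.
move=> mw; apply: measurable_prod => s _; apply: measurable_fun_ifT => //.
  exact: past_measurable_alloc_eqb.
exact: past_measurable_observation.
Qed.

Lemma past_measurable_pull_sum w a t :
  (forall x, measurable_fun setT (w x)) ->
  measurable_fun [set: pastType Xs Y t] (pull_sum w a t).
Proof.
move=> mw; apply: measurable_sum => s; apply: measurable_fun_ifT => //.
  exact: past_measurable_alloc_eqb.
exact: past_measurable_observation.
Qed.

Lemma pull_prod_ge0 w a t o : (forall x y, 0 <= w x y) -> 0 <= pull_prod w a t o.
Proof. by move=> w0; apply: prodr_ge0 => s _; case: ifP. Qed.

Lemma pull_prod_expR h a t o :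
  pull_prod (fun x y => expR (h x y)) a t o = expR (pull_sum h a t o).
Proof.
rewrite expR_sum; apply: eq_bigr => s _.
by case: ifP => // _; rewrite expR0.
Qed.

Lemma pull_sumD h1 h2 a t o :
  pull_sum (fun x y => h1 x y + h2 x y) a t o = pull_sum h1 a t o + pull_sum h2 a t o.
Proof.
by rewrite -big_split; apply: eq_bigr => s _ /=; case: ifP => // _; rewrite addr0.
Qed.

Lemma pull_sumZ c h a t o :
  pull_sum (fun x y => c * h x y) a t o = c * pull_sum h a t o.
Proof.
by rewrite mulr_sumr; apply: eq_bigr => s _; case: ifP => // _; rewrite mulr0.
Qed.

Lemma pull_sum_cst c a t o :
  pull_sum (fun _ _ => c) a t o = c * (pulls a t o)%:R.
Proof.
rewrite natr_sum mulr_sumr; apply: eq_bigr => s _.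
by case: (arm_eqb _ _); rewrite ?mulr1 ?mulr0.
Qed.

Lemma ler_pull_sum h1 h2 a t o : (forall x y, h1 x y <= h2 x y) ->
  pull_sum h1 a t o <= pull_sum h2 a t o.
Proof. by move=> h12; apply: ler_sum => s _; case: ifP. Qed.

End adapted.

(** * Moment bounds under adaptive sampling *)

Section model_bounds.
Context {R : realType} {X : finType} {d : measure_display} {Omega : measurableType d}.
Variables (F : R -> X -> probability R R) (g : X -> R) (P : probability Omega R).
Variables (C : R * R) (Xs : nat -> Omega -> X) (Y : arm -> nat -> Omega -> R).
Hypothesis mod : model F g P C Xs Y.
Hypothesis g0 : forall x, 0 < g x.
Variable phi : @rule R X.
Hypothesis mphi : measurable_rule phi.
Local Notation alloc := (alloc phi Xs Y).
Local Notation pulls := (pulls Xs Y phi).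
Local Notation pull_prod := (pull_prod Xs Y phi).
Local Notation pull_sum := (pull_sum Xs Y phi).

Lemma past_measurable_fun t (f : Omega -> R) :
  measurable_fun [set: pastType Xs Y t] f -> measurable_fun setT f.
Proof. exact/measurable_fun_generated/(past_rect_measurable mod). Qed.

Lemma measurable_pulls_le a t N : measurable [set o | (pulls a t o <= N)%N].
Proof.
rewrite (_ : [set _ | _] = setT `&` [set o | (pulls a t o)%:R <= N%:R :> R]).
  apply: measurable_fun_le => //; apply: (@past_measurable_fun t).
  exact: past_measurable_pulls.
by rewrite setTI; apply/seteqP; split => o /=; rewrite ler_nat.
Qed.

Lemma measurable_context_count x0 t :
  measurable_fun setT (fun o => (\sum_(s < t) (Xs s o == x0))%:R : R).
Proof.
under eq_fun do rewrite natr_sum.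
apply: measurable_sum => s; apply: measurable_fun_nat_bool.
apply: (measurable_fun_context (f := fun x _ => x == x0)) => // x.
by case: mod.
Qed.

(** The product is a supermartingale: a pull multiplies it by a factor of conditional mean at most
    1, any other round by 1. *)
Lemma pull_prod_le1 (w : X -> R -> R) a t :
  (forall x, measurable_fun setT (w x)) -> (forall x y, 0 <= w x y) ->
  (forall x, \int[F (cfg_par C a) x]_y (w x y)%:E <= 1)%E ->
  (\int[P]_o (pull_prod w a t o)%:E <= 1)%E.
Proof.
move=> mw w0 w1; elim: t => [|t IH].
  under eq_integral do rewrite /pull_prod big_ord0.
  by rewrite integral_cst//= probability_setT mule1.
apply: le_trans IH.
have mprod : measurable_fun [set: pastType Xs Y t] (pull_prod w a t).
  exact: past_measurable_pull_prod.
(* [W true] and [W false] split the product according to whether [a] is pulled at time [t]; both are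
   past-measurable once the context is fixed. *)
pose W b x o := pull_prod w a t o * (arm_eqb (alloc_at Xs Y phi t x o) a == b)%:R.
have mW b x : measurable_fun [set: pastType Xs Y t] (W b x).
  apply: measurable_funM => //; apply: measurable_fun_nat_bool.
  case: b; under eq_fun do rewrite ?eqb_id ?eqbF_neg.
    exact: past_measurable_alloc_at_eqb.
  by apply: measurable_neg; exact: past_measurable_alloc_at_eqb.
have W0 b x o : 0 <= W b x o by rewrite mulr_ge0// pull_prod_ge0.
have mWX b : measurable_fun setT (fun o => W b (Xs t o) o).
  apply: (measurable_fun_context (f := W b)) => x; first by case: mod.
  exact: past_measurable_fun (mW b x).
have mwXY : measurable_fun setT (fun o => w (Xs t o) (Y a t o)).
  by apply: (@past_measurable_fun t.+1); exact: past_measurable_observation.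
rewrite [leLHS](_ : _ =
    (\int[P]_o ((W true (Xs t o) o * w (Xs t o) (Y a t o))%:E +
                (W false (Xs t o) o)%:E))%E); last first.
  apply: eq_integral => o _; rewrite -EFinD /W /pull_prod big_ord_recr /= alloc_atE.
  by case: (arm_eqb _ _); rewrite /= ?mulr1 ?mulr0 ?mul0r ?addr0 ?add0r.
rewrite ge0_integralD//; last 4 first.
- by move=> o _; rewrite lee_fin mulr_ge0.
- by apply/measurable_EFinP; exact: measurable_funM.
- by move=> o _; rewrite lee_fin.
- exact/measurable_EFinP.
apply: (@le_trans _ _ (\int[P]_o (W true (Xs t o) o)%:E +
                       \int[P]_o (W false (Xs t o) o)%:E)%E).
  apply: leeD2r; rewrite -[leRHS]mul1e.
  exact: (integral_past_step_le mod g0).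
rewrite -ge0_integralD//; last 4 first.
- by move=> o _; rewrite lee_fin.
- exact/measurable_EFinP.
- by move=> o _; rewrite lee_fin.
- exact/measurable_EFinP.
rewrite (_ : (\int[P]_o _)%E = (\int[P]_o (pull_prod w a t o)%:E)%E)//.
apply: eq_integral => o _; rewrite -EFinD /W -mulrDr.
by case: (arm_eqb _ _); rewrite /= ?addr0 ?add0r mulr1.
Qed.

(* Only the first [N] pulls of arm [a] are counted, so the sum has at most [N] terms. *)
Definition capped_pull_sum (N : nat) (w : X -> R -> R) (a : arm) (t : nat)
    (o : Omega) : R :=
  \sum_(s < t) ((arm_eqb (alloc s o) a && (pulls a s o < N)%N)%:R
                * w (Xs s o) (Y a s o)).

Lemma capped_pull_sumE N w a t o : (pulls a t o <= N)%N ->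
  capped_pull_sum N w a t o = pull_sum w a t o.
Proof.
elim: t => [|t IH]; first by rewrite /capped_pull_sum /pull_sum !big_ord0.
rewrite /pulls big_ord_recr /= => h.
rewrite /capped_pull_sum /pull_sum !big_ord_recr /=; congr (_ + _).
  exact/IH/(leq_trans (leq_addr _ _) h).
case: (arm_eqb _ _) h => /=; last by rewrite mul0r.
by rewrite addn1 /pulls => ->; rewrite mul1r.
Qed.

(** As in Wald's inequality: whether round [s] is counted is decided by the strict past and the
    current context, each counted term has conditional mean at most [c], and at most [N] terms are
    counted. The bound is therefore free of [t]. *)
Lemma capped_pull_sum_le N (w : X -> R -> R) a t c :
  (forall x, measurable_fun setT (w x)) -> (forall x y, 0 <= w x y) -> 0 <= c ->
  (forall x, \int[F (cfg_par C a) x]_y (w x y)%:E <= c%:E)%E ->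
  (\int[P]_o (capped_pull_sum N w a t o)%:E <= (c * N%:R)%:E)%E.
Proof.
move=> mw w0 c0 wc.
pose W s x o : R := (arm_eqb (alloc_at Xs Y phi s x o) a && (pulls a s o < N)%N)%:R.
have mW s x : measurable_fun [set: pastType Xs Y s] (W s x).
  apply: measurable_fun_nat_bool; apply: measurable_and.
    exact: past_measurable_alloc_at_eqb.
  under eq_fun do rewrite -(ltr_nat R).
  by apply: measurable_fun_ltr => //; exact: past_measurable_pulls.
have mWX s : measurable_fun setT (fun o => W s (Xs s o) o).
  apply: (measurable_fun_context (f := W s)) => x; first by case: mod.
  exact: past_measurable_fun (mW s x).
have mwXY s : measurable_fun setT (fun o => w (Xs s o) (Y a s o)).
  by apply: (@past_measurable_fun s.+1); exact: past_measurable_observation.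
under eq_integral do rewrite /capped_pull_sum -sumEFin.
rewrite ge0_integral_sum//; last 2 first.
- move=> s; apply/measurable_EFinP; apply: measurable_funM => //.
  under eq_fun do rewrite alloc_atE; exact: mWX.
- by move=> s o _; rewrite lee_fin mulr_ge0.
apply: (@le_trans _ _ (\sum_(s < t) (c%:E * \int[P]_o (W s (Xs s o) o)%:E))%E).
  apply: lee_sum => s _; under eq_integral do rewrite alloc_atE.
  exact: (integral_past_step_le mod g0 (W := W s)).
rewrite -ge0_sume_distrr; last first.
  by move=> s _; apply: integral_ge0 => o _; rewrite lee_fin.
rewrite EFinM; apply: lee_wpmul2l; first by rewrite lee_fin.
rewrite -ge0_integral_sum//; last 2 first.
- by move=> s; exact/measurable_EFinP.
- by move=> s o _; rewrite lee_fin.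
apply: (@le_trans _ _ (\int[P]_o (N%:R)%:E)%E); last first.
  by rewrite integral_cst//= probability_setT mule1.
apply: ge0_le_integral => //.
- by move=> o _; apply: sume_ge0 => s _; rewrite lee_fin.
- by apply: emeasurable_sum => s; exact/measurable_EFinP.
move=> o _; rewrite sumEFin lee_fin /W.
under eq_bigr do rewrite -alloc_atE.
rewrite -natr_sum ler_nat.
exact: (sum_lt_counter (fun s => arm_eqb (alloc s o) a)).
Qed.

Lemma integral_context_prod (v : X -> R) t : (forall x, 0 <= v x) ->
  (\int[P]_o (\prod_(s < t) v (Xs s o))%:E =
   ((\sum_(x in X) g x * v x) ^+ t)%:E)%E.
Proof.
move=> v0; elim: t => [|t IH].
  under eq_integral do rewrite big_ord0.
  by rewrite integral_cst//= probability_setT mule1.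
under eq_integral do rewrite big_ord_recr /=.
have mv s x : measurable_fun [set: pastType Xs Y s] (fun o => \prod_(r < s) v (Xs r o)).
  apply: measurable_prod => r _.
  by apply: (@past_measurable_observation _ _ _ _ Xs Y r s arm1 (fun x _ => v x)).
rewrite (@integral_past_step _ _ _ _ _ _ _ _ _ _ mod g0 t arm1
  (fun _ o => \prod_(s < t) v (Xs s o)) (fun x _ => v x))//; last 2 first.
- by move=> x; exact: mv.
- by move=> x o; exact: prodr_ge0.
under eq_bigr => x _ do rewrite IH integral_cst//= probability_setT mule1 -!EFinM.
by rewrite sumEFin -mulr_sumr exprSr.
Qed.

End model_bounds.

(** * Change of measure *)

Section path_law.
Context {R : realType} {X : finType} {d : measure_display} {Omega : measurableType d}.
Variables (F : R -> X -> probability R R) (g : X -> R) (P : probability Omega R).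
Variables (C : R * R) (Xs : nat -> Omega -> X) (Y : arm -> nat -> Omega -> R).
Hypothesis mod : model F g P C Xs Y.
Hypothesis g0 : forall x, 0 < g x.
Variables (xs : nat -> X) (ars : nat -> arm).

(** A deterministic path reads a single arm in each round, so the joint law of the two rewards of a
    round never enters. *)
Lemma integral_path_prod (v : nat -> R -> R) t :
  (forall s, measurable_fun setT (v s)) -> (forall s y, 0 <= v s y) ->
  (\int[P]_o (\prod_(s < t) ((Xs s o == xs s)%:R * v s (Y (ars s) s o)))%:E =
   \prod_(s < t) ((g (xs s))%:E * \int[F (cfg_par C (ars s)) (xs s)]_y (v s y)%:E))%E.
Proof.
move=> mv v0; elim: t => [|t IH].
  under eq_integral do rewrite big_ord0.
  by rewrite integral_cst//= probability_setT mule1 big_ord0.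
under eq_integral do rewrite big_ord_recr /=.
rewrite (@integral_past_step _ _ _ _ _ _ _ _ _ _ mod g0 t (ars t)
  (fun _ o => \prod_(s < t) ((Xs s o == xs s)%:R * v s (Y (ars s) s o)))
  (fun x y => (x == xs t)%:R * v t y)); last 4 first.
- move=> _; apply: measurable_prod => s _.
  apply: (@past_measurable_observation _ _ _ _ Xs Y s t (ars s)
    (fun x y => (x == xs s)%:R * v s y)) => // x.
  exact: measurable_funM.
- by move=> _ o; apply: prodr_ge0 => s _; rewrite mulr_ge0.
- by move=> x; exact: measurable_funM.
- by move=> x y; rewrite mulr_ge0.
rewrite (bigD1 (xs t))//= big1 ?adde0.
  rewrite IH big_ord_recr /=; congr (_ * (_ * _))%E.
  by apply: eq_integral => y _; rewrite eqxx mul1r.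
move=> x xt; rewrite [X in (_ * (_ * X))%E]integral0_eq ?mule0// => y _.
by rewrite (negbTE xt) mul0r.
Qed.

(** Only the rewards read along the path occur; contexts are left out because they are frozen
    separately by [context_path]. *)
Definition path_rect (t : nat) : set (set Omega) :=
  [set E | exists B : nat -> set R, (forall s, measurable (B s)) /\
     E = \bigcap_(s in `I_t) [set o | B s (Y (ars s) s o)]].

Lemma path_rectT t : path_rect t setT.
Proof. by exists (fun=> setT); split => //; apply/seteqP; split. Qed.

Lemma path_rectI t : setI_closed (path_rect t).
Proof.
move=> _ _ [A [mA ->]] [B [mB ->]].
exists (fun s => A s `&` B s); split; first by move=> s; exact: measurableI.
apply/seteqP; split => [w [] h h' s st|w h]; first by split; [exact: h|exact: h'].
by split => s st; have [] := h s st.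
Qed.

Lemma path_rect_measurable t : path_rect t `<=` measurable.
Proof.
have [_ mY _ _] := mod.
move=> _ [B [mB ->]]; apply: fin_bigcap_measurable => // s _.
by rewrite -[X in measurable X]setTI; exact: mY.
Qed.

Lemma path_measurable_reward s t : (s < t)%N ->
  measurable_fun [set: g_sigma_algebraType (path_rect t)] (Y (ars s) s).
Proof.
move=> st _ B mB; rewrite setTI; apply: sub_sigma_algebra.
exists (fun r => if r == s then B else setT); split; first by move=> r; case: ifP.
apply/seteqP; split => [w /= h r rt /=|w h]; first by case: eqVneq => // ->.
by have := h s st; rewrite /= eqxx.
Qed.

Definition context_path (t : nat) : set Omega :=
  \bigcap_(s in `I_t) [set o | Xs s o = xs s].

Lemma measurable_context_path t : measurable (context_path t).
Proof. by have [mX _ _ _] := mod; apply: fin_bigcap_measurable => // s _. Qed.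

Lemma prod_bool_nat (t : nat) (b : nat -> bool) :
  \prod_(s < t) (b s)%:R = (`[< forall s, (s < t)%N -> b s >])%:R :> R.
Proof.
elim: t => [|t IH]; first by rewrite big_ord0 asboolT.
rewrite big_ord_recr /= IH -natrM mulnb; congr (nat_of_bool _)%:R.
apply/andP/asboolP => [[/asboolP h bt] s|h].
  by rewrite ltnS leq_eqVlt => /orP[/eqP->|/h].
by split; [apply/asboolP => s st; apply: h; exact: ltnW|exact: h].
Qed.

Lemma indic_context_path t o :
  \1_(context_path t) o = \prod_(s < t) (Xs s o == xs s)%:R :> R.
Proof.
rewrite (prod_bool_nat t (fun s => Xs s o == xs s)) indicE; congr (nat_of_bool _)%:R.
apply/idP/asboolP => [|h]; first by rewrite inE => h s /h /eqP.
by rewrite inE => s /h /eqP.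
Qed.

Lemma indic_path_rect t (B : nat -> set R) o :
  \1_(\bigcap_(s in `I_t) [set o | B s (Y (ars s) s o)]) o =
  \prod_(s < t) \1_(B s) (Y (ars s) s o) :> R.
Proof.
under eq_bigr do rewrite indicE.
rewrite (prod_bool_nat t (fun s => Y (ars s) s o \in B s)) indicE.
congr (nat_of_bool _)%:R.
apply/idP/asboolP => [|h]; first by rewrite inE => h s /h; rewrite inE.
by rewrite inE => s /h; rewrite inE.
Qed.

End path_law.

Section change_of_measure.
Context {R : realType} {X : finType} {d : measure_display} {Omega : measurableType d}.
Variables (F : R -> X -> probability R R) (g : X -> R) (P P' : probability Omega R).
Variables (C C' : R * R) (Xs : nat -> Omega -> X) (Y : arm -> nat -> Omega -> R).
Hypothesis mod : model F g P C Xs Y.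
Hypothesis mod' : model F g P' C' Xs Y.
Hypothesis g0 : forall x, 0 < g x.
Variable phi : @rule R X.
Hypothesis mphi : measurable_rule phi.
Local Notation alloc := (alloc phi Xs Y).
Local Notation pull_sum := (pull_sum Xs Y phi).
Variables (a : arm) (f l : X -> R -> R).
Hypothesis same_other : cfg_par C (other a) = cfg_par C' (other a).
Hypothesis mf : forall x, measurable_fun setT (f x).
Hypothesis ml : forall x, measurable_fun setT (l x).
Hypothesis f0 : forall x y, 0 <= f x y.
Hypothesis fl : forall x y, f x y <= expR (l x y).
Hypothesis f_density : forall x B, measurable B ->
  F (cfg_par C a) x B = (\int[F (cfg_par C' a) x]_(y in B) (f x y)%:E)%E.

Section fixed_path.
Variables (xs : nat -> X) (ars : nat -> arm).

(** The other arm has the same law in both configurations, whence ratio 1 and log-ratio 0 in its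
    rounds. *)
Let fs s y := if arm_eqb (ars s) a then f (xs s) y else 1.
Let ls s y := if arm_eqb (ars s) a then l (xs s) y else 0.

Let mfs s : measurable_fun setT (fs s).
Proof. by rewrite /fs; case: (arm_eqb (ars s) a). Qed.

Let mls s : measurable_fun setT (ls s).
Proof. by rewrite /ls; case: (arm_eqb (ars s) a). Qed.

Let fs0 s y : 0 <= fs s y.
Proof. by rewrite /fs; case: ifP. Qed.

Let fsls s y : fs s y <= expR (ls s y).
Proof. by rewrite /fs /ls; case: ifP => // _; rewrite expR0. Qed.

Let fs_density s B : measurable B ->
  F (cfg_par C (ars s)) (xs s) B =
  (\int[F (cfg_par C' (ars s)) (xs s)]_(y in B) (fs s y)%:E)%E.
Proof.
move=> mB; rewrite /fs; case: arm_eqP => [->|na]; first exact: f_density.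
have -> : ars s = other a by case: (ars s) a na => -[].
by rewrite integral_cst// mul1e same_other.
Qed.

Let h t o : R := \1_(context_path Xs xs t) o * \prod_(s < t) fs s (Y (ars s) s o).

Let mh t : measurable_fun setT (h t).
Proof.
apply: measurable_funM.
  exact/measurable_indic/(measurable_context_path mod).
apply: measurable_prod => s _; apply: measurableT_comp => //.
by case: mod.
Qed.

Let h0 t o : 0 <= h t o.
Proof. by rewrite mulr_ge0 ?indicE// prodr_ge0. Qed.

(** On rectangles both sides factor by [integral_path_prod]; the context weights are the same under
    [P] and [P'], and the reward factors are related by [fs_density]. The pi-lambda argument does
    the rest. *)
Lemma path_density t E : <<s path_rect Y ars t >> E ->
  P (E `&` context_path Xs xs t) = (\int[P']_(o in E) (h t o)%:E)%E.
Proof.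
move=> hE.
have mU := measurable_context_path mod xs t.
have := @finite_measure_unique_generated R _ Omega _ (mrestr P mU)
  (density P' (h0 t) (mh t)) (@path_rect_measurable _ _ _ _ _ _ _ _ _ _ mod ars t) (path_rectT Y ars t)
  (@path_rectI _ _ _ Y ars t) _ _ _ hE.
apply.
  by rewrite /= /mrestr (le_lt_trans (probability_le1 P _)) ?ltry//; exact: measurableI.
move=> _ [B [mB ->]] /=; rewrite /mrestr /density.
set E' := \bigcap_(s in _) _.
have mE' : measurable E' by apply: (path_rect_measurable mod); exists B.
have IE o : \1_E' o = \prod_(s < t) \1_(B s) (Y (ars s) s o) :> R.
  exact: (indic_path_rect Y ars t B o).
have mEU : measurable (E' `&` context_path Xs xs t) by exact: measurableI.
have mB1 s : measurable_fun setT (\1_(B s) : R -> R) by exact/measurable_indic.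
transitivity (\int[P]_o (\1_(E' `&` context_path Xs xs t) o)%:E)%E.
  by rewrite integral_indic// setIT.
transitivity (\prod_(s < t) ((g (xs s))%:E *
    \int[F (cfg_par C (ars s)) (xs s)]_y (\1_(B s) y)%:E))%E.
  have B0 s y : 0 <= \1_(B s) y :> R by rewrite indicE.
  rewrite -[RHS](integral_path_prod mod g0 xs ars t mB1 B0).
  apply: eq_integral => o _; rewrite indicI /= indic_context_path IE.
  by rewrite -big_split /=; congr EFin; apply: eq_bigr => s _; rewrite mulrC.
transitivity (\prod_(s < t) ((g (xs s))%:E *
    \int[F (cfg_par C' (ars s)) (xs s)]_y (\1_(B s) y * fs s y)%:E))%E.
  apply: eq_bigr => s _; congr (_ * _)%E.
  transitivity (F (cfg_par C (ars s)) (xs s) (B s)).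
    by rewrite integral_indic// setIT.
  rewrite fs_density// [LHS]integral_mkcond.
  apply: eq_integral => y _; rewrite patchE indicE.
  by case: ifP; rewrite ?mul1r ?mul0r.
have mBf s : measurable_fun setT (fun y => \1_(B s) y * fs s y).
  exact: measurable_funM.
have Bf0 s y : 0 <= \1_(B s) y * fs s y by rewrite mulr_ge0 ?indicE.
rewrite -[LHS](integral_path_prod mod' g0 xs ars t mBf Bf0).
rewrite [RHS]integral_mkcond; apply: eq_integral => o _.
rewrite patchE /h indic_context_path.
transitivity (\1_E' o * (\prod_(s < t) (Xs s o == xs s)%:R *
   \prod_(s < t) fs s (Y (ars s) s o)))%:E.
  rewrite IE -!big_split /=; congr EFin; apply: eq_bigr => s _.
  by rewrite mulrCA.
by rewrite indicE; case: ifP; rewrite ?mul1r ?mul0r.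
Qed.

Definition path_event (t : nat) : set Omega :=
  [set o | forall s, (s < t)%N -> Xs s o = xs s /\ alloc s o = ars s].

Definition reward_path_event (t : nat) : set Omega :=
  [set o | forall s, (s < t)%N ->
     phi (fun i : 'I_s.+1 => xs i) (fun i : 'I_s => Y (ars i) i o) = ars s].

Lemma alloc_on_path s o :
  (forall r, (r <= s)%N -> Xs r o = xs r) ->
  (forall r, (r < s)%N -> alloc r o = ars r) ->
  alloc s o = phi (fun i : 'I_s.+1 => xs i) (fun i : 'I_s => Y (ars i) i o).
Proof.
move=> hX ha; rewrite /Defs.alloc; congr (phi _ _); apply/funext => i.
  by rewrite hX// -ltnS.
by rewrite nth_obs// ha.
Qed.

(** As long as the path has been followed, the history shown to the rule consists of the rewards of
    [ars]. Induction on time thus removes the feedback in [alloc] and exhibits an event to which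
    [path_density] applies. *)
Lemma path_eventE t :
  path_event t = reward_path_event t `&` context_path Xs xs t.
Proof.
apply/seteqP; split => [ o ho|o [hr hX] s st].
  split => s /= st; last by have [] := ho s st.
  rewrite -alloc_on_path; first by have [] := ho s st.
    by move=> r rs; have [] := ho r (leq_ltn_trans rs st).
  by move=> r rs; have [] := ho r (ltn_trans rs st).
split; first exact: hX.
elim/ltn_ind: s st => s IH st; rewrite alloc_on_path; first exact: hr.
  by move=> r rs; apply: hX; exact: leq_ltn_trans st.
by move=> r rs; apply: IH => //; exact: ltn_trans st.
Qed.

Lemma measurable_reward_path_event t :
  <<s path_rect Y ars t >> (reward_path_event t).
Proof.
pose GT : measurableType _ := g_sigma_algebraType (path_rect Y ars t).
rewrite (_ : reward_path_event t = \bigcap_(s in `I_t)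
    [set o | phi (fun i : 'I_s.+1 => xs i) (fun i : 'I_s => Y (ars i) i o) = ars s])//.
apply: (@fin_bigcap_measurable _ GT) => // s st.
apply: (@measurable_rule_comp R X _ GT phi s (fun i _ => xs i)
  (fun i o => Y (ars i) i o)) => //.
  move=> i x; have [->|/eqP xx0] := eqVneq (xs i) x.
    by rewrite (_ : [set _ | _] = setT)//; apply/seteqP; split.
  by rewrite (_ : [set _ | _] = set0)//; apply/seteqP; split.
move=> i; apply: path_measurable_reward; exact: ltn_trans (ltn_ord i) st.
Qed.

Lemma measurable_path_event t : measurable (path_event t).
Proof.
rewrite path_eventE; apply: measurableI; last exact: (measurable_context_path mod).
apply: (generated_measurable (@path_rect_measurable _ _ _ _ _ _ _ _ _ _ mod ars t)).
exact: measurable_reward_path_event.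
Qed.

Lemma path_change_of_measure t b :
  (P (path_event t `&` [set o | (pull_sum l a t o <= b)%R]) <=
   (expR b)%:E * P' (path_event t))%E.
Proof.
(* On the path [pull_sum] equals this sum over prescribed arms, which, unlike [pull_sum], is a
   function of the rewards of the path alone. *)
pose Z := [set o | \sum_(s < t) ls s (Y (ars s) s o) <= b].
pose GT : measurableType _ := g_sigma_algebraType (path_rect Y ars t).
have mZ : <<s path_rect Y ars t >> Z.
  rewrite -[Z]setTI; apply: (@measurable_fun_le _ GT R setT
    (fun o => \sum_(s < t) ls s (Y (ars s) s o)) (cst b)) => //.
  apply: measurable_sum => s; apply: measurableT_comp => //.
  exact: path_measurable_reward.
have LZ o : path_event t o -> pull_sum l a t o = \sum_(s < t) ls s (Y (ars s) s o).
  move=> ho; apply: eq_bigr => s _; have [hX ha] := ho s (ltn_ord s).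
  by rewrite /ls ha hX; case: arm_eqP => // ->.
rewrite (_ : path_event t `&` _ =
    (reward_path_event t `&` Z) `&` context_path Xs xs t); last first.
  rewrite setIAC -path_eventE; apply/seteqP; split => o [ho] /=.
    by rewrite LZ.
  by rewrite /Z /= -LZ.
have mDZ : <<s path_rect Y ars t >> (reward_path_event t `&` Z).
  by apply: (@measurableI _ GT) => //; exact: measurable_reward_path_event.
have mDZ' : measurable (reward_path_event t `&` Z).
  exact: (generated_measurable (@path_rect_measurable _ _ _ _ _ _ _ _ _ _ mod ars t)).
have mU := measurable_context_path mod xs t.
rewrite path_density//.
apply: (@le_trans _ _ (\int[P']_(o in reward_path_event t `&` Z)
    (expR b * \1_(context_path Xs xs t) o)%:E)%E).
  apply: ge0_le_integral => //.
  - by move=> o _; rewrite lee_fin h0.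
  - by apply/measurable_EFinP; exact: measurable_funS (mh t).
  - by apply/measurable_EFinP; exact: measurable_funM.
  move=> o [_ Zo]; rewrite lee_fin mulrC; apply: ler_wpM2l; first by rewrite indicE.
  apply: le_trans (_ : expR (\sum_(s < t) ls s (Y (ars s) s o)) <= _).
    rewrite expR_sum; apply: ler_prod => s _; rewrite fs0; exact: fsls.
  by rewrite ler_expR.
under eq_integral do rewrite EFinM.
rewrite ge0_integralZl//; last exact/measurable_EFinP.
apply: lee_wpmul2l; first by rewrite lee_fin expR_ge0.
rewrite integral_indic// path_eventE; apply: le_measure; rewrite ?inE.
- exact: measurableI.
- by rewrite -path_eventE; exact: measurable_path_event.
by move=> o [? []].
Qed.

End fixed_path.

Variable x0 : X.

(** A boolean stands for the arm so that the paths form a finite type. *)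
Definition alloc_path (t : nat) (o : Omega) : {ffun 'I_t -> X * bool} :=
  [ffun s : 'I_t => (Xs s o, arm_eqb (alloc s o) a)].

(** The defaults [x0] and [a] only turn a finite path into functions on all times; [path_event]
    never looks at times from [t] on. *)
Lemma alloc_path_event t (p : {ffun 'I_t -> X * bool}) :
  [set o | alloc_path t o = p] =
  path_event (fun s => if insub s is Some k then (p k).1 else x0)
    (fun s => if insub s is Some k then (if (p k).2 then a else other a) else a) t.
Proof.
have ao c : (if arm_eqb c a then a else other a) = c by case: c; case: a.
apply/seteqP; split => [ o /= <- s st|o h].
  by rewrite insubT /= ffunE /= ao.
apply/ffunP => s; rewrite ffunE; have := h s (ltn_ord s).
rewrite /= valK => -[-> ->].
by case: (p s) => x [] /=; congr pair; case: a.
Qed.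

(** The event given by [q] is a finite disjoint union of paths, and the factor [expR b] is the same
    on each, so the path bounds add up. *)
Lemma change_of_measure t b (q : pred {ffun 'I_t -> X * bool}) :
  (P ([set o | q (alloc_path t o)] `&` [set o | (pull_sum l a t o <= b)%R]) <=
   (expR b)%:E * P' [set o | q (alloc_path t o)])%E.
Proof.
have finq : finite_set [set p | q p] by exact: finite_finset.
have mZ : measurable [set o | pull_sum l a t o <= b].
  rewrite -[X in measurable X]setTI; apply: measurable_fun_le => //.
  apply: (past_measurable_fun mod (t := t)); exact: past_measurable_pull_sum.
have mp p : measurable [set o | alloc_path t o = p].
  by rewrite alloc_path_event; exact: measurable_path_event.
have qE : [set o | q (alloc_path t o)] =
    \bigcup_(p in [set p | q p]) [set o | alloc_path t o = p].
  apply/seteqP; split => [ o qo|o [p qp /= ->]//].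
  by exists (alloc_path t o).
rewrite qE setI_bigcupl measure_fin_bigcup//; last 2 first.
- by move=> p r _ _ [ o [[/= <- _] [/= <-]]].
- by move=> p _; exact: measurableI.
rewrite measure_fin_bigcup//; last first.
- by move=> p r _ _ [ o [/= <- <-]].
rewrite ge0_mule_fsumr//.
by apply: lee_fsum => // p _; rewrite alloc_path_event; exact: path_change_of_measure.
Qed.

End change_of_measure.

(** * Likelihood ratios and clipped moments *)

Section relative_entropy.
Context {R : realType} {d : measure_display} {T : measurableType d}.

(** The integral is the difference of the integrals of the two parts, with [+oo - +oo] equal to
    [-oo]. Positivity excludes an infinite negative part, and finiteness then excludes an infinite
    positive one. *)
Lemma integrable_of_fin_integral (mu : {measure set T -> \bar R}) (f : T -> \bar R) :
  measurable_fun setT f -> (0 < \int[mu]_x f x)%E -> (\int[mu]_x f x < +oo)%E ->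
  mu.-integrable setT f.
Proof.
move=> mf; rewrite integralE.
have p0 : (0 <= \int[mu]_x f^\+ x)%E by exact: integral_ge0.
have n0 : (0 <= \int[mu]_x f^\- x)%E by exact: integral_ge0.
have ig (h : T -> \bar R) : measurable_fun setT h -> (forall x, 0 <= h x)%E ->
    (\int[mu]_x h x < +oo)%E -> mu.-integrable setT h.
  move=> mh h0 hoo; apply/integrableP; split => //.
  by under eq_integral do rewrite gee0_abs//.
move=> h1 h2.
have [poo noo] : (\int[mu]_x f^\+ x < +oo)%E /\ (\int[mu]_x f^\- x < +oo)%E.
  move: p0 n0 h1 h2.
  by case: (\int[mu]_x f^\+ x)%E => [p| |]; case: (\int[mu]_x f^\- x)%E => [n| |];
    rewrite ?ltry.
rewrite (funeposneg f); apply: integrableB => //; apply: ig => //.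
  exact: measurable_funepos.
exact: measurable_funeneg.
Qed.

(* [l] is the log-likelihood ratio and [f] the likelihood ratio made nonnegative
   everywhere; [f <= expR l] also holds where [f] vanishes, although [ln 0 = 0]. *)
Lemma KL_density (P Q : probability T R) :
  (0 < KL P Q)%E -> (KL P Q < +oo)%E ->
  exists f l : T -> R,
    [/\ measurable_fun setT f, measurable_fun setT l,
        (forall y, 0 <= f y /\ f y <= expR (l y)),
        (forall B, measurable B -> P B = (\int[Q]_(y in B) (f y)%:E)%E) &
        P.-integrable setT (EFin \o l) /\ (\int[P]_y (l y)%:E = KL P Q)%E].
Proof.
rewrite /KL; case: pselect => // PQ KL0 KLoo.
set rn := Radon_Nikodym (charge_of_finite_measure P) Q in KL0 KLoo *.
have mrn : measurable_fun setT rn.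
  by apply: measurable_int; exact: Radon_Nikodym_integrable.
have mfrn : measurable_fun setT (fine \o rn) by exact: measurableT_comp.
have ml : measurable_fun setT (fun y => ln (fine (rn y))).
  exact: measurableT_comp (@measurable_ln R) mfrn.
have mmax : measurable_fun setT (fun y => Num.max (fine (rn y)) 0).
  exact: measurable_maxr.
exists (fun y => Num.max (fine (rn y)) 0), (fun y => ln (fine (rn y))).
split => //.
- move=> y; rewrite le_max lexx orbT; split => //.
  rewrite ge_max expR_ge0 andbT; have [r0|r0] := ltP 0 (fine (rn y)).
    by rewrite lnK.
  exact: le_trans r0 (expR_ge0 _).
- move=> B mB; rewrite (@Radon_Nikodym_SigmaFinite.f_integral _ _ _ _ Q PQ)//.
  have fI := Radon_Nikodym_SigmaFinite.f_integrable PQ.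
  apply: ae_eq_integral => //.
  + by apply: measurable_funTS; exact: measurable_int fI.
  + by apply: measurable_funTS; exact/measurable_EFinP.
  (* The derivative agrees almost everywhere with a finite nonnegative version, so the maximum with
     0 changes it on a null set only. *)
  have := ae_eq_Radon_Nikodym_SigmaFinite PQ mB.
  apply: filterS => y yB /yB; rewrite -/rn => <-.
  rewrite -[in LHS](fineK (Radon_Nikodym_SigmaFinite.f_fin_num PQ y)).
  congr EFin; apply/esym/max_idPl; apply: fine_ge0.
  exact: Radon_Nikodym_SigmaFinite.f_ge0.
- split => //; apply: integrable_of_fin_integral => //.
  exact/measurable_EFinP.
Qed.

Lemma markov_set (P : probability T R) (E : set T) (V : T -> R) (c : R) :
  measurable E -> measurable_fun setT V -> (forall o, 0 <= V o) -> 0 <= c ->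
  (forall o, E o -> c <= V o) ->
  (c%:E * P E <= \int[P]_o (V o)%:E)%E.
Proof.
move=> mE mV V0 c0 EV.
rewrite -[in leLHS](setIT E) -integral_indic// -ge0_integralZl//; last first.
- exact/measurable_EFinP.
apply: ge0_le_integral => //.
- by move=> o _; rewrite -EFinM lee_fin mulr_ge0.
- by apply/measurable_EFinP; exact: measurable_funM.
- exact/measurable_EFinP.
move=> o _; rewrite -EFinM lee_fin indicE.
by case: (boolP (o \in E)); rewrite ?inE ?mulr1 ?mulr0// => /EV.
Qed.

(** Dominated convergence: at each point the excess vanishes once [n] exceeds the absolute value of
    [l], which is also the dominating function. *)
Lemma excess_cvg0 (P : probability T R) (l : T -> R) :
  P.-integrable setT (EFin \o l) ->
  ((\int[P]_y (Num.max (`|l y| - n%:R) 0)%:E)%E @[n --> \oo] --> 0%E).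
Proof.
move=> il.
have ml : measurable_fun setT l by apply/measurable_EFinP; exact: measurable_int il.
have [||||| _ _] := @dominated_convergence _ T R P setT measurableT
  (fun n y => (Num.max (`|l y| - n%:R) 0)%:E) (cst 0%E) (fun y => `|(l y)%:E|%E).
- move=> n; apply/measurable_EFinP; apply: measurable_maxr => //.
  apply: measurable_funB => //; exact: measurableT_comp.
- exact: measurable_cst.
- apply: aeW => y _; apply: cvg_near_cst; near=> n.
  congr EFin; apply/max_idPr; rewrite subr_le0.
  by near: n; exact: nbhs_infty_ger.
- exact: integrable_abse.
- apply: aeW => y n _; rewrite lee_fin ger0_norm ?le_max ?lexx ?orbT//.
  by rewrite ge_max normr_ge0 andbT gerBl.
by rewrite integral_cst// mul0e.
Unshelve. all: by end_near. Qed.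

End relative_entropy.

(** From [1 - u <= expR (- u)] one gets [(1 - u) * expR u <= 1], while [(1 - u) * (1 + u + 2 * u^2)
    = 1 + u^2 * (1 - 2 * u)] is at least 1. *)
Lemma expR_le_quadratic (R : realType) (u : R) : `|u| <= 1 / 2 ->
  expR u <= 1 + u + 2 * u ^+ 2.
Proof.
move=> hu; have := expR_ge1Dx (- u); rewrite expRN => h.
have {hu}[u1 u2] : - (1/2) <= u /\ u <= 1/2 by move: hu; rewrite ler_norml => /andP.
have e0 := expR_gt0 u.
have {}h : (1 - u) * expR u <= 1 by rewrite -ler_pdivlMr// mul1r.
have p0 : 0 < 1 - u by lra.
rewrite -(ler_pM2l p0); apply: le_trans h _; nra.
Qed.

(** * Concentration of the log-likelihood *)

Lemma measurable_set_lt (R : realType) (d : measure_display) (T : measurableType d)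
    (f h : T -> R) :
  measurable_fun setT f -> measurable_fun setT h -> measurable [set x | f x < h x].
Proof.
move=> mf mh.
by have := measurable_fun_ltr mf mh measurableT (Logic.I : measurable [set true]); rewrite setTI.
Qed.

Section concentration.
Context {R : realType} {X : finType} {d : measure_display} {Omega : measurableType d}.
Variables (F : R -> X -> probability R R) (g : X -> R) (P : probability Omega R).
Variables (C : R * R) (Xs : nat -> Omega -> X) (Y : arm -> nat -> Omega -> R).
Hypothesis mod : model F g P C Xs Y.
Hypothesis g0 : forall x, 0 < g x.
Hypothesis g1 : \sum_(x in X) g x = 1.
Variable phi : @rule R X.
Hypothesis mphi : measurable_rule phi.
Local Notation pulls := (pulls Xs Y phi).
Local Notation pull_prod := (pull_prod Xs Y phi).
Local Notation pull_sum := (pull_sum Xs Y phi).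

(** Chernoff's bound with exponent [-1]: the weight [v] averages to some [q < 1], and the contexts
    are independent. *)
Lemma context_frequency (x0 : X) : exists2 c : R, 0 < c &
  forall t, (P [set o | ((\sum_(s < t) (Xs s o == x0))%:R < c * t%:R)%R] <=
             (expR (- (c * t%:R)))%:E)%E.
Proof.
pose v x : R := if x == x0 then expR (- 1) else 1.
have v0 x : 0 < v x by rewrite /v; case: ifP => // _; exact: expR_gt0.
pose q := \sum_(x in X) g x * v x.
have q0 : 0 < q.
  rewrite /q (bigD1 x0)//= ltr_pwDl ?mulr_gt0//.
  by apply: sumr_ge0 => x _; rewrite mulr_ge0 ?ltW.
have q1 : q < 1.
  rewrite -g1 /q (bigD1 x0)//= [ltRHS](bigD1 x0)//=; apply: ltr_leD.
    by rewrite gtr_pMr// /v eqxx expR_lt1 oppr_lt0.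
  by apply: ler_sum => x xx0; rewrite /v (negbTE xx0) mulr1.
have lq : ln q < 0 by rewrite ln_lt0// q0 q1.
(* With this value [q^t = expR (- 2 * c * t)]: half of the decay pays for the threshold in Markov's
   inequality, half remains. *)
exists (- ln q / 2); first by rewrite divr_gt0// oppr_gt0.
move=> t; set c := - ln q / 2; set E := [set o | _].
have mprod : measurable_fun setT (fun o => \prod_(s < t) v (Xs s o)).
  apply: measurable_prod => s _.
  apply: (measurable_fun_context (f := fun x _ => v x)) => // x.
  by case: mod.
have mE : measurable E.
  by apply: measurable_set_lt => //; exact: (measurable_context_count mod).
have := @markov_set R _ Omega P E (fun o => \prod_(s < t) v (Xs s o))
  (expR (- (c * t%:R))) mE mprod _ (expR_ge0 _) _.
rewrite (integral_context_prod mod g0)//; last by move=> x; exact: ltW.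
rewrite -/q => /(_ _ _) M.
have {M} : ((expR (- (c * t%:R)))%:E * P E <= (q ^+ t)%:E)%E.
  apply: M => o; first by apply: prodr_ge0 => s _; exact: ltW.
  rewrite /E /= => Eo.
  have -> : \prod_(s < t) v (Xs s o) = expR (- (\sum_(s < t) (Xs s o == x0))%:R).
    rewrite natr_sum -sumrN expR_sum; apply: eq_bigr => s _.
    by rewrite /v; case: ifP => // _; rewrite oppr0 expR0.
  by rewrite ler_expR lerN2 ltW.
have -> : (q ^+ t)%:E = ((expR (- (c * t%:R)))%:E * (expR (- (c * t%:R)))%:E)%E.
  rewrite -EFinM -expRD -[in LHS](lnK (x := q))// -expRM_natr; congr (expR _)%:E.
  by rewrite /c; field.
by rewrite lee_pmul2l// lte_fin expR_gt0.
Qed.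

Variables (a : arm) (l : X -> R -> R) (k : R).
Hypothesis k0 : 0 <= k.
Hypothesis il : forall x, (F (cfg_par C a) x).-integrable setT (EFin \o l x).
Hypothesis lk : forall x, (\int[F (cfg_par C a) x]_y (l x y)%:E <= k%:E)%E.

Let ml x : measurable_fun setT (l x).
Proof. by apply/measurable_EFinP; exact: measurable_int (il x). Qed.

(* [l <= clip + excess] splits the log-likelihood ratio into a bounded part,
   controlled by an exponential supermartingale, and a part of small mean. *)
Let clip (M : R) x y : R := Num.max (- M) (Num.min (l x y) M).
Let excess (M : R) x y : R := Num.max (`|l x y| - M) 0.

Let mclip (M : R) x : measurable_fun setT (clip M x).
Proof. by apply: measurable_maxr => //; exact: measurable_minr. Qed.

Let mexcess (M : R) x : measurable_fun setT (excess M x).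
Proof.
apply: measurable_maxr => //; apply: measurable_funB => //.
exact: measurableT_comp.
Qed.

Let excess_ge0 (M : R) x y : 0 <= excess M x y.
Proof. by rewrite /excess le_max lexx orbT. Qed.

Let clip_excess (M : R) x y : 0 <= M ->
  [/\ l x y <= clip M x y + excess M x y, clip M x y <= l x y + excess M x y &
      `|clip M x y| <= M].
Proof.
rewrite /clip /excess; move: (l x y) => u M0.
have [h1|h1] := leP u M; last first.
  have [h2|h2] := leP (- M) M; last by lra.
  have [h3|h3] := leP (`|u| - M) 0; rewrite gtr0_norm in h3 *; try lra.
  by split; try lra; rewrite ger0_norm.
have [h2|h2] := leP (- M) u.
  have [h3|h3] := leP (`|u| - M) 0; split; try lra; by rewrite ler_norml h1 h2.
have un : `|u| = - u by rewrite ltr0_norm; lra.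
have [h3|h3] := leP (`|u| - M) 0; rewrite un in h3 *; split; try lra;
  by rewrite normrN ger0_norm.
Qed.

(** One level [M] serves all contexts because [X] is finite. *)
Lemma excess_small (e : R) : 0 < e -> exists2 M : R, 1 <= M &
  forall x, (\int[F (cfg_par C a) x]_y (excess M x y)%:E <= e%:E)%E.
Proof.
move=> e0.
have H x : \forall n \near \oo,
    (\int[F (cfg_par C a) x]_y (excess n%:R x y)%:E <= e%:E)%E.
  have /fine_cvgP[fin] := excess_cvg0 (il x).
  move=> /cvgrPdist_le/(_ e e0) near_e; near=> n.
  have finn : (\int[F (cfg_par C a) x]_y (excess n%:R x y)%:E)%E \is a fin_num.
    by near: n.
  rewrite -[leLHS]fineK// lee_fin.
  have : `|0 - fine (\int[F (cfg_par C a) x]_y (excess n%:R x y)%:E)%E| <= e by near: n.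
  by rewrite sub0r normrN; exact/le_trans/ler_norm.
have [N _ HN] := filter_forall _ H.
exists (maxn N 1)%:R; first by rewrite ler1n leq_maxr.
by move=> x; apply: HN => /=; exact: leq_maxl.
Unshelve. all: by end_near. Qed.

(** By [expR_le_quadratic], [expR (lam * clip)] has mean at most
    [1 + lam * (k + e + 2 * lam * M^2)]. One [e] accounts for the truncation and the other for the
    quadratic term; [1 + z <= expR z] concludes. *)
Lemma clip_exp_moment (M e lam : R) x : 1 <= M -> 0 <= lam -> lam * M <= 1 / 2 ->
  2 * lam * M ^+ 2 <= e ->
  (\int[F (cfg_par C a) x]_y (excess M x y)%:E <= e%:E)%E ->
  (\int[F (cfg_par C a) x]_y (expR (lam * clip M x y - lam * (k + 2 * e)))%:E <= 1)%E.
Proof.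
move=> M1 lam0 lamM lamM2 ex; set Q := F (cfg_par C a) x.
have M0 : 0 <= M by lra.
pose u y := 1 + 2 * (lam * M) ^+ 2 + lam * (l x y + excess M x y).
have expu y : expR (lam * clip M x y) <= u y.
  have lc : `|lam * clip M x y| <= lam * M.
    by rewrite normrM (ger0_norm lam0); apply: ler_wpM2l => //; by case: (clip_excess x y M0).
  apply: le_trans (expR_le_quadratic (le_trans lc lamM)) _.
  have : (lam * clip M x y) ^+ 2 <= (lam * M) ^+ 2.
    by rewrite -[leLHS]real_normK ?num_real//; apply: lerXn2r => //; rewrite nnegrE ?mulr_ge0.
  have : lam * clip M x y <= lam * (l x y + excess M x y).
    by apply: ler_wpM2l => //; case: (clip_excess x y M0).
  rewrite /u; lra.
have iexc : Q.-integrable setT (EFin \o excess M x).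
  apply: (le_integrable measurableT _ _ (integrable_abse (il x))).
    exact/measurable_EFinP.
  move=> y _; rewrite /= lee_fin normr_id ger0_norm// /excess ge_max normr_ge0 andbT.
  by rewrite gerBl.
have iu : (\int[Q]_y (u y)%:E <= (1 + lam * (k + 2 * e))%:E)%E.
  have isum : Q.-integrable setT (fun y => (l x y)%:E + (excess M x y)%:E)%E.
    exact: (integrableD measurableT (il x) iexc).
  rewrite [leLHS](_ : _ = (\int[Q]_y ((1 + 2 * (lam * M) ^+ 2)%:E +
      lam%:E * ((l x y)%:E + (excess M x y)%:E)))%E); last first.
    by apply: eq_integral => y _; rewrite /u (EFinD (1 + _)) EFinM (EFinD (l x y)).
  rewrite integralD//; last 2 first.
  - exact: finite_measure_integrable_cst.
  - exact: integrableZl.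
  rewrite integral_cst//= probability_setT mule1 integralZl//.
  rewrite (integralD measurableT (il x) iexc).
  apply: (@le_trans _ _ ((1 + 2 * (lam * M) ^+ 2)%:E + lam%:E * (k%:E + e%:E))%E).
    apply: leeD2l; apply: lee_wpmul2l; rewrite ?lee_fin//.
    exact: leeD (lk x) ex.
  rewrite -(EFinD k) -EFinM -EFinD lee_fin.
  have := ler_wpM2l lam0 lamM2.
  nra.
under eq_integral do rewrite expRD mulrC EFinM.
have mexp : measurable_fun setT (fun y => expR (lam * clip M x y)).
  apply: measurableT_comp; first exact: measurable_expR.
  exact: measurable_funM.
rewrite ge0_integralZl//; last exact/measurable_EFinP.
apply: (@le_trans _ _ ((expR (- (lam * (k + 2 * e))))%:E * (1 + lam * (k + 2 * e))%:E)%E).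
  apply: lee_wpmul2l; first by rewrite lee_fin expR_ge0.
  apply: le_trans iu; apply: ge0_le_integral => //.
  - exact/measurable_EFinP.
  - apply/measurable_EFinP; apply: measurable_funD => //; apply: measurable_funM => //.
    exact: measurable_funD.
  - by move=> y _; rewrite lee_fin.
rewrite -EFinM lee_fin expRN mulrC ler_pdivrMr ?expR_gt0// mul1r.
exact: expR_ge1Dx.
Qed.

Lemma likelihood_concentration (del eta : R) : 0 < del -> 0 < eta ->
  exists2 lam : R, 0 < lam & forall t N, (0 < N)%N ->
    (P [set o | (pulls a t o <= N)%N /\ (N%:R * (k + del) < pull_sum l a t o)%R] <=
     (eta + expR (- (lam * N%:R)))%:E)%E.
Proof.
move=> del0 eta0.
have [e e0 delE] : exists2 e, 0 < e & del = 4 * e.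
  by exists (del / 4); [rewrite divr_gt0|field].
(* The bound by [e] enters the exponential moment; the bound by [eta * e] makes Markov's inequality
   at level [N * e] return [eta]. *)
pose e1 := Num.min e (eta * e).
have e10 : 0 < e1 by rewrite lt_min e0 mulr_gt0.
have [M M1 exM] := excess_small e10.
(* The two terms are the two smallness conditions on [lam] in [clip_exp_moment]. *)
pose lam := Num.min (1 / (2 * M)) (e / (2 * M ^+ 2)).
have M0 : 0 < M by lra.
have lam0 : 0 < lam by rewrite lt_min !divr_gt0// mulr_gt0// exprn_gt0.
have lamM : lam * M <= 1 / 2.
  have : lam <= 1 / (2 * M) by rewrite ge_min lexx.
  rewrite ler_pdivlMr ?mulr_gt0// => ?; lra.
have lamM2 : 2 * lam * M ^+ 2 <= e.
  have : lam <= e / (2 * M ^+ 2) by rewrite ge_min lexx orbT.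
  rewrite ler_pdivlMr ?mulr_gt0 ?exprn_gt0// => ?; lra.
exists (lam * e); first exact: mulr_gt0.
move=> t N N0.
have N0' : 0 < N%:R :> R by rewrite ltr0n.
have mcl := past_measurable_fun mod
  (past_measurable_pull_sum (Xs := Xs) (Y := Y) mphi (t := t) a (mclip M)).
(* Of the slack [del = 4 * e], the clipped sum receives [3 * e] and the excess [e]. *)
pose A := [set o | (pulls a t o <= N)%N /\ N%:R * (k + 3 * e) < pull_sum (clip M) a t o].
pose B := [set o | (pulls a t o <= N)%N /\ N%:R * e < pull_sum (excess M) a t o].
have mpN := measurable_pulls_le mod mphi a t N.
have mA : measurable A.
  by apply: measurableI => //; exact: measurable_set_lt.
have mB : measurable B.
  apply: measurableI => //; apply: measurable_set_lt => //; apply: (past_measurable_fun mod (t := t)).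
  exact: past_measurable_pull_sum.
have subAB : [set o | (pulls a t o <= N)%N /\ N%:R * (k + del) < pull_sum l a t o]
    `<=` A `|` B.
  move=> o [pN lN]; have [cl|cl] := ltP (N%:R * (k + 3 * e)) (pull_sum (clip M) a t o).
    by left.
  right; split => //.
  have : pull_sum l a t o <= pull_sum (clip M) a t o + pull_sum (excess M) a t o.
    rewrite -pull_sumD; apply: ler_pull_sum => x y.
    by case: (clip_excess x y (ltW M0)).
  by move: lN cl; rewrite delE !mulrDr; lra.
(* On [A] there are at most [N] pulls, so the compensator is at most [lam * (k + 2 * e) * N] and the
   product is at least [expR (lam * e * N)]. Evaluating at the single time [t] is enough; no maximal
   inequality is called for. *)
have PA : (P A <= (expR (- (lam * e * N%:R)))%:E)%E.
  pose w x y := expR (lam * clip M x y - lam * (k + 2 * e)).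
  have mw x : measurable_fun setT (w x).
    apply: measurableT_comp; first exact: measurable_expR.
    by apply: measurable_funB => //; exact: measurable_funM.
  have w0 x y : 0 <= w x y by exact: expR_ge0.
  have mprod : measurable_fun setT (pull_prod w a t).
    apply: (past_measurable_fun mod (t := t)); exact: past_measurable_pull_prod.
  have w1 : (\int[P]_o (pull_prod w a t o)%:E <= 1)%E.
    apply: (pull_prod_le1 mod g0 mphi) => // x; apply: clip_exp_moment => //.
      exact: ltW.
    by apply: le_trans (exM x) _; rewrite lee_fin ge_min lexx.
  have : ((expR (lam * e * N%:R))%:E * P A <= 1)%E.
    apply: le_trans w1; apply: markov_set => //.
    - by move=> o; exact: pull_prod_ge0.
    move=> o [pN cl]; rewrite pull_prod_expR ler_expR.
    rewrite (pull_sumD Xs Y phi (fun x y => lam * clip M x y) (fun _ _ => - (lam * (k + 2 * e)))).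
    rewrite pull_sumZ pull_sum_cst.
    have h1 : lam * (N%:R * (k + 3 * e)) <= lam * pull_sum (clip M) a t o.
      by rewrite ler_pM2l// ltW.
    have h2 : lam * (k + 2 * e) * (pulls a t o)%:R <= lam * (k + 2 * e) * N%:R.
      by apply: ler_wpM2l; rewrite ?ler_nat//; apply: mulr_ge0; [exact: ltW|];
        rewrite addr_ge0// mulr_ge0// ltW.
    lra.
  rewrite -lee_pdivlMl ?expR_gt0// mule1 => /le_trans; apply.
  by rewrite expRN.
(* Under the constraint of at most [N] pulls the capped sum is the full one, and its mean is at most
   [eta * e * N]. *)
have PB : (P B <= eta%:E)%E.
  have mcap : measurable_fun setT (capped_pull_sum Xs Y phi N (excess M) a t).
    apply: measurable_sum => s; apply: measurable_funM.
      apply: measurable_fun_nat_bool; apply: measurable_and.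
        apply: (measurable_fun_generated (past_rect_measurable mod (t := s.+1))).
        exact: past_measurable_alloc_eqb.
      under eq_fun do rewrite -(ltr_nat R).
      apply: measurable_fun_ltr => //; apply: (past_measurable_fun mod (t := s)).
      exact: past_measurable_pulls.
    apply: (past_measurable_fun mod (t := s.+1)).
    exact: past_measurable_observation.
  have : ((N%:R * e)%:E * P B <= (eta * e * N%:R)%:E)%E.
    apply: (@le_trans _ _ (\int[P]_o (capped_pull_sum Xs Y phi N (excess M) a t o)%:E)%E).
      apply: markov_set => //.
      - by move=> o; apply: sumr_ge0 => s _; rewrite mulr_ge0.
      - by rewrite mulr_ge0 ?ltW.
      by move=> o [pN /ltW]; rewrite capped_pull_sumE.
    apply: (capped_pull_sum_le mod g0 mphi) => //; first by rewrite mulr_ge0 ?ltW.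
    by move=> x; apply: le_trans (exM x) _; rewrite lee_fin ge_min lexx orbT.
  rewrite (_ : eta * e * N%:R = N%:R * e * eta); last by ring.
  by rewrite [in leRHS]EFinM lee_pmul2l// lte_fin mulr_gt0.
have mAB : measurable (A `|` B) by exact: measurableU.
apply: (@le_trans _ _ (P (A `|` B))).
  apply: le_measure; rewrite ?inE//.
  apply: measurableI => //; apply: measurable_set_lt => //; apply: (past_measurable_fun mod (t := t)).
  exact: past_measurable_pull_sum.
apply: (le_trans (measureU2 P mA mB)).
by rewrite EFinD addeC; exact: leeD.
Qed.

End concentration.

(** * The lower bound for one alternative *)

Lemma ln_nat_near (R : realType) (A : R) : \forall t \near \oo, A <= ln t%:R.
Proof.
near=> t; have At : expR A <= t%:R by near: t; exact: nbhs_infty_ger.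
by rewrite -ler_expR lnK// posrE (lt_le_trans (expR_gt0 A)).
Unshelve. all: by end_near. Qed.

(** With [u = ln x], the exponential series gives [u^2 / 2 <= x], and [u <= del * u^2 / 2] as soon
    as [u >= 2 / del]. *)
Lemma ln_le_linear (R : realType) (del x : R) : 0 < del -> 0 < x ->
  2 / del <= ln x -> ln x <= del * x.
Proof.
move=> del0 x0 lx; have l0 : 0 <= ln x.
  by apply: le_trans lx; rewrite divr_ge0// ltW.
have := expR_ge1Dxn 1 l0; rewrite lnK// => h.
rewrite ler_pdivrMr// in lx.
apply: (@le_trans _ _ (del * (ln x ^+ 2 / 2))).
  rewrite expr2 mulrA ler_pdivlMr// mulrA mulrC [del * _]mulrC.
  exact: ler_wpM2r.
rewrite ler_pM2l//; apply: le_trans h; rewrite lerDr//.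
Qed.

Section inferior_pulls.
Context {R : realType} {X : finType} {d : measure_display} {Omega : measurableType d}.
Variables (F : R -> X -> probability R R).
Variables (Xs : nat -> Omega -> X) (Y : arm -> nat -> Omega -> R).
Variable phi : @rule R X.
Hypothesis mphi : measurable_rule phi.
Local Notation pulls := (pulls Xs Y phi).
Local Notation Tinf := (Tinf F phi Xs Y).

Lemma Tinf_pulls C j t o :
  (forall x, mean F (cfg_par C (other j)) x < mean F (cfg_par C j) x) ->
  Tinf C t o = pulls (other j) t o.
Proof.
move=> h; apply: eq_bigr => s _; congr nat_of_bool; rewrite /inferior.
have := h (Xs s o).
by case: j {h} => /= h; case: (alloc _ _ _ _ _) => //=; apply/negbTE; rewrite -leNgt ltW.
Qed.

(** In a round with context [x0], the rule either pulls [j], which is an error under [C], or pulls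
    the other arm. *)
Lemma context_count_le C j x0 t o :
  mean F (cfg_par C j) x0 < mean F (cfg_par C (other j)) x0 ->
  (\sum_(s < t) (Xs s o == x0) <= Tinf C t o + pulls (other j) t o)%N.
Proof.
move=> h; rewrite -big_split /=; apply: leq_sum => s _.
case: eqVneq => // ->; rewrite /inferior.
case: (alloc _ _ _ _ _); case: j h => /= h; rewrite ?h ?addn1//.
Qed.

Lemma past_measurable_Tinf C t :
  measurable_fun [set: pastType Xs Y t] (fun o => (Tinf C t o)%:R : R).
Proof.
rewrite (_ : (fun _ => _) = (fun o => \sum_(s < t)
    (if arm_eqb (alloc phi Xs Y s o) arm1 then (inferior F C (Xs s o) arm1)%:R
     else (inferior F C (Xs s o) arm2)%:R : R))); last first.
  apply/funext => o; rewrite natr_sum; apply: eq_bigr => s _.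
  by case: (alloc _ _ _ _ _).
apply: measurable_sum => s; apply: measurable_fun_ifT.
- exact: past_measurable_alloc_eqb.
- by apply: (@past_measurable_observation _ _ _ _ Xs Y s t arm1
    (fun x _ => (inferior F C x arm1)%:R)).
- by apply: (@past_measurable_observation _ _ _ _ Xs Y s t arm1
    (fun x _ => (inferior F C x arm2)%:R)).
Qed.

Lemma Tinf_le C t o : (Tinf C t o <= t)%N.
Proof.
rewrite -[leqRHS]card_ord -sum1_card; apply: leq_sum => s _.
exact: leq_b1.
Qed.

Lemma integral_Tinf_fin_num (P : probability Omega R) C t :
  measurable_fun setT (fun o => (Tinf C t o)%:R : R) ->
  (\int[P]_o ((Tinf C t o)%:R)%:E)%E \is a fin_num.
Proof.
move=> mT; rewrite ge0_fin_numE; last first.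
  by apply: integral_ge0 => o _; rewrite lee_fin.
apply: (@le_lt_trans _ _ (\int[P]_o (t%:R)%:E)%E); last first.
  by rewrite integral_cst//= probability_setT mule1 ltry.
apply: ge0_le_integral => //.
- exact/measurable_EFinP.
- by move=> o _; rewrite lee_fin ler_nat Tinf_le.
Qed.

End inferior_pulls.

Section lai_robbins.
Context {R : realType} {X : finType} {d : measure_display} {Omega : measurableType d}.
Variables (F : R -> X -> probability R R) (g : X -> R) (P P' : probability Omega R).
Variables (C C' : R * R) (Xs : nat -> Omega -> X) (Y : arm -> nat -> Omega -> R).
Hypothesis mod : model F g P C Xs Y.
Hypothesis mod' : model F g P' C' Xs Y.
Hypothesis g0 : forall x, 0 < g x.
Hypothesis g1 : \sum_(x in X) g x = 1.
Variable phi : @rule R X.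
Hypothesis mphi : measurable_rule phi.
Local Notation pulls := (pulls Xs Y phi).
Local Notation pull_sum := (pull_sum Xs Y phi).
Local Notation Tinf := (Tinf F phi Xs Y).
Variables (j : arm) (k : R) (x0 : X).
Hypothesis same_j : cfg_par C j = cfg_par C' j.
Hypothesis better : mean F (cfg_par C' j) x0 < mean F (cfg_par C' (other j)) x0.
Hypothesis KL_gt0 : forall x, (0 < KLcond F (cfg_par C (other j)) (cfg_par C' (other j)) x)%E.
Hypothesis KL_le : forall x,
  (KLcond F (cfg_par C (other j)) (cfg_par C' (other j)) x <= k%:E)%E.
Hypothesis k0 : 0 < k.
Hypothesis good' : forall alpha : R, 0 < alpha ->
  (fun t : nat => fine (\int[P']_w ((Tinf C' t w)%:R)%:E)%E / (t%:R `^ alpha)) @ \oo --> 0.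

(** On this event at least [c * t - N >= c * t / 2] rounds are errors under [C']; Markov's
    inequality concludes. *)
Lemma alternative_bound (c : R) t N :
  0 < c -> (0 < t)%N -> N%:R <= c * t%:R / 2 ->
  (P' [set o | (pulls (other j) t o <= N)%N /\
               (c * t%:R <= (\sum_(s < t) (Xs s o == x0))%:R)%R] <=
   (2 / (c * t%:R) * fine (\int[P']_w ((Tinf C' t w)%:R)%:E)%E)%:E)%E.
Proof.
move=> c0 t0 Nct; set A := [set o | _].
have t0' : 0 < t%:R :> R by rewrite ltr0n.
have mT : measurable_fun setT (fun o => (Tinf C' t o)%:R : R).
  by apply: (past_measurable_fun mod' (t := t)); exact: past_measurable_Tinf.
have mA : measurable A.
  apply: measurableI; first exact: (measurable_pulls_le mod').
  rewrite -[X in measurable X]setTI; apply: measurable_fun_le => //.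
  exact: (measurable_context_count mod').
have ct0 : 0 < c * t%:R by rewrite mulr_gt0.
have : ((c * t%:R / 2)%:E * P' A <= \int[P']_w ((Tinf C' t w)%:R)%:E)%E.
  apply: markov_set => //; first by rewrite divr_ge0// ltW.
  move=> o [pN ct].
  have : (\sum_(s < t) (Xs s o == x0))%:R <= (Tinf C' t o)%:R + (pulls (other j) t o)%:R :> R.
    by rewrite -natrD ler_nat; exact: context_count_le.
  have : (pulls (other j) t o)%:R <= N%:R :> R by rewrite ler_nat.
  move: ct; lra.
rewrite -lee_pdivlMl ?divr_gt0// => /le_trans; apply.
rewrite -[in leLHS](fineK (integral_Tinf_fin_num P' mT)) -EFinM lee_fin.
by rewrite invf_div.
Qed.

Lemma few_pulls_unlikely (eps eta : R) : 0 < eps < 1 -> 0 < eta ->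
  \forall t \near \oo,
    (P [set o | ((pulls (other j) t o)%:R < (1 - eps) / k * ln t%:R)%R] <= eta%:E)%E.
Proof.
move=> /andP[eps0 eps1] eta0.
have KL_lty x : (KLcond F (cfg_par C (other j)) (cfg_par C' (other j)) x < +oo)%E.
  exact: le_lt_trans (KL_le x) (ltry k).
have /choice[f /choice[l fl]] := fun x => KL_density (KL_gt0 x) (KL_lty x).
have mf x : measurable_fun setT (f x) by case: (fl x).
have ml x : measurable_fun setT (l x) by case: (fl x).
have f0 x y : 0 <= f x y by have [_ _ /(_ y)[]] := fl x.
have fle x y : f x y <= expR (l x y) by have [_ _ /(_ y)[]] := fl x.
have fd x B : measurable B -> F (cfg_par C (other j)) x B =
    (\int[F (cfg_par C' (other j)) x]_(y in B) (f x y)%:E)%E.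
  by have [_ _ _ h _] := fl x; exact: h.
have il x : (F (cfg_par C (other j)) x).-integrable setT (EFin \o l x).
  by have [_ _ _ _ []] := fl x.
have lk x : (\int[F (cfg_par C (other j)) x]_y (l x y)%:E <= k%:E)%E.
  by have [_ _ _ _ [_ ->]] := fl x; exact: KL_le.
(* Chosen so that [(k + del) * (1 - eps) / k = (1 - eps) * (1 + eps / 2)]. *)
have [del del0 delE] : exists2 del, 0 < del & del = k * eps / 2.
  by exists (k * eps / 2) => //; rewrite divr_gt0// mulr_gt0.
have eta4 : 0 < eta / 4 by rewrite divr_gt0.
have [lam lam0 conc] := likelihood_concentration mod g0 mphi (ltW k0) il lk del0 eta4.
have [c c0 freq] := context_frequency mod g0 g1 x0.
have eps2 : 0 < eps / 2 by rewrite divr_gt0.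
have [b b0 bE] : exists2 b, 0 < b & b = (1 - eps) / k.
  by exists ((1 - eps) / k) => //; rewrite divr_gt0// subr_gt0.
rewrite -bE.
have oth2 : other (other j) = j by case: (j).
have e0 : 0 < eta / 4 * (c / 2) by rewrite mulr_gt0// divr_gt0.
have /cvgrPdist_le/(_ _ e0) good_near := good' eps2.
near=> t.
have t0 : (0 < t)%N by near: t; exact: nbhs_infty_gt.
have t0' : 0 < t%:R :> R by rewrite ltr0n.
(* The three thresholds on [ln t] yield, in this order, [N > 0], [expR (- (lam * N)) <= eta / 4],
   and [N <= c * t / 2]. *)
have ln1 : 2 / b <= ln t%:R by near: t; exact: ln_nat_near.
have ln2 : ((- ln (eta / 4)) / lam + 1) / b <= ln t%:R by near: t; exact: ln_nat_near.
have ln3 : 2 / (c / (2 * b)) <= ln t%:R by near: t; exact: ln_nat_near.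
have ct : (- ln (eta / 4)) / c <= t%:R by near: t; exact: nbhs_infty_ger.
have Tsmall : fine (\int[P']_w ((Tinf C' t w)%:R)%:E)%E / (t%:R `^ (eps / 2))
    <= eta / 4 * (c / 2).
  have : `|0 - fine (\int[P']_w ((Tinf C' t w)%:R)%:E)%E / (t%:R `^ (eps / 2))|
      <= eta / 4 * (c / 2).
    by near: t; exact: good_near.
  by rewrite sub0r normrN; exact/le_trans/ler_norm.
have lnt0 : 0 <= ln t%:R :> R by rewrite ln_ge0// ler1n.
pose N := Num.truncn (b * ln t%:R).
have /andP[N1 N2] : N%:R <= b * ln t%:R < N.+1%:R.
  by apply: truncn_itv; rewrite mulr_ge0// ltW.
have NR0 : b * ln t%:R - 1 < N%:R by rewrite ltrBlDr natr1.
have N0 : (0 < N)%N.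
  rewrite -(ltr_nat R); apply: lt_trans NR0; rewrite ler_pdivrMr// in ln1.
  by move: ln1; lra.
have expN : expR (- (lam * N%:R)) <= eta / 4.
  rewrite -[leRHS]lnK ?posrE// ler_expR.
  rewrite ler_pdivrMr// in ln2.
  have : - ln (eta / 4) / lam <= N%:R by move: ln2 NR0; lra.
  rewrite ler_pdivrMr//; lra.
have expct : expR (- (c * t%:R)) <= eta / 4.
  rewrite -[leRHS]lnK ?posrE// ler_expR.
  move: ct; rewrite ler_pdivrMr//; lra.
have Nct : N%:R <= c * t%:R / 2.
  apply: (le_trans N1).
  have := ln_le_linear _ t0' ln3; rewrite divr_gt0 ?mulr_gt0// => /(_ isT) h.
  have := ler_wpM2l (ltW b0) h.
  rewrite (_ : b * (c / (2 * b) * t%:R) = c * t%:R / 2)//.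
  by field; rewrite gt_eqF.
have Nb : N%:R * (k + del) <= (1 - eps / 2) * ln t%:R.
  apply: (@le_trans _ _ (b * ln t%:R * (k + del))).
    by apply: ler_wpM2r => //; rewrite ltW// addr_gt0.
  rewrite mulrAC; apply: ler_wpM2r => //.
  have -> : b * (k + del) = (1 - eps) * (1 + eps / 2).
    by rewrite bE delE; field; rewrite gt_eqF.
  have : 0 <= eps * eps by rewrite mulr_ge0 ?ltW.
  by lra.
(* Frequency of [x0] belongs to the event carried to [P'], where Markov's inequality then applies
   directly; its failure is [E2], bounded under [P]. *)
pose q (p : {ffun 'I_t -> X * bool}) := (\sum_(s < t) (p s).2 <= N)%N &&
  (c * t%:R <= (\sum_(s < t) ((p s).1 == x0))%:R :> R).
pose Q := [set o | (pulls (other j) t o <= N)%N /\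
                   c * t%:R <= (\sum_(s < t) (Xs s o == x0))%:R].
have qE : [set o | q (alloc_path Xs Y phi (other j) t o)] = Q.
  have e1 o : (\sum_(s < t) (alloc_path Xs Y phi (other j) t o s).2)%N =
      pulls (other j) t o by apply: eq_bigr => s _; rewrite ffunE.
  have e2 o : (\sum_(s < t) ((alloc_path Xs Y phi (other j) t o s).1 == x0))%N =
      (\sum_(s < t) (Xs s o == x0))%N by apply: eq_bigr => s _; rewrite ffunE.
  by apply/seteqP; split => o; rewrite /Q /q /= e1 e2; [move=> /andP[]|case=> -> ->].
have same : cfg_par C (other (other j)) = cfg_par C' (other (other j)) by rewrite oth2.
pose L := pull_sum l (other j) t.
pose bN := N%:R * (k + del).
have cm := change_of_measure mod mod' g0 mphi same mf ml f0 fle fd x0 (t := t) bN q.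
rewrite qE in cm.
have mL : measurable_fun setT L.
  by apply: (past_measurable_fun mod (t := t)); exact: past_measurable_pull_sum.
have mpulls : measurable_fun setT (fun o => (pulls (other j) t o)%:R : R).
  by apply: (past_measurable_fun mod (t := t)); exact: past_measurable_pulls.
have mfreq := measurable_context_count mod x0 t.
have mpN := measurable_pulls_le mod mphi (other j) t N.
pose E1 := [set o | (pulls (other j) t o <= N)%N /\ bN < L o].
pose E2 := [set o | (\sum_(s < t) (Xs s o == x0))%:R < c * t%:R].
pose E3 := Q `&` [set o | L o <= bN].
have mE1 : measurable E1 by apply: measurableI => //; exact: measurable_set_lt.
have mE2 : measurable E2 by exact: measurable_set_lt.
have mE3 : measurable E3.
  apply: measurableI; last first.
    by rewrite -[X in measurable X]setTI; exact: measurable_fun_le.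
  apply: measurableI => //.
  by rewrite -[X in measurable X]setTI; exact: measurable_fun_le.
(* The cost [t^(1 - eps/2)] times the bound under [P'] is [2 / c] times the normalized expected
   error count, and the tolerance in [Tsmall] was set to cancel [2 / c]. *)
have PE3 : (P E3 <= (eta / 4)%:E)%E.
  apply: (le_trans cm); apply: (@le_trans _ _ ((expR ((1 - eps / 2) * ln t%:R))%:E *
      (2 / (c * t%:R) * fine (\int[P']_w ((Tinf C' t w)%:R)%:E)%E)%:E)%E).
    apply: lee_pmul => //; first by rewrite lee_fin ler_expR.
    exact: alternative_bound.
  rewrite -EFinM lee_fin.
  have -> : expR ((1 - eps / 2) * ln t%:R) = t%:R / (t%:R `^ (eps / 2)).
    by rewrite mulrBl mul1r expRB lnK ?posrE// /powR gt_eqF.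
  move: Tsmall; set T := fine _; set p := _ `^ _ => Tsmall.
  have -> : t%:R / p * (2 / (c * t%:R) * T) = 2 / c * (T / p).
    have p0 : 0 < p by exact: powR_gt0.
    by field; rewrite !gt_eqF.
  apply: (@le_trans _ _ (2 / c * (eta / 4 * (c / 2)))).
    by apply: ler_wpM2l => //; rewrite divr_ge0// ltW.
  by rewrite le_eqVlt; apply/orP; left; apply/eqP; field; rewrite gt_eqF.
apply: (@le_trans _ _ (P (E1 `|` (E2 `|` E3)))).
  apply: le_measure; rewrite ?inE.
  - exact: measurable_set_lt mpulls (measurable_cst _).
  - by do 2 apply: measurableU => //.
  move=> o /= pb; have pN : (pulls (other j) t o <= N)%N.
    by rewrite -ltnS -(ltr_nat R); exact: lt_trans N2.
  have [h|h] := ltP bN (L o); first by left.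
  have [h'|h'] := ltP (\sum_(s < t) (Xs s o == x0))%:R (c * t%:R); first by right; left.
  by right; right.
apply: (le_trans (measureU2 P mE1 (measurableU _ _ mE2 mE3))).
apply: (@le_trans _ _ ((eta / 4 + eta / 4)%:E + (P E2 + P E3))%E).
  apply: leeD => //; last exact: measureU2.
  by apply: le_trans (conc t N N0) _; rewrite lee_fin lerD2l.
apply: (@le_trans _ _ ((eta / 4 + eta / 4)%:E + ((eta / 4)%:E + (eta / 4)%:E))%E).
  apply: leeD => //; apply: leeD => //.
  by apply: le_trans (freq t) _; rewrite lee_fin.
by rewrite -!EFinD lee_fin; lra.
Unshelve. all: by end_near. Qed.

End lai_robbins.

(** * From one alternative to the infimum *)

Lemma le_limn_einf (R : realType) (u : (\bar R)^nat) (c : \bar R) :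
  (\forall t \near \oo, c <= u t)%E -> (c <= limn_einf u)%E.
Proof.
move=> [N _ h]; rewrite limn_einf_lim (cvg_lim _ (@cvg_einfs_sup _ u))//.
apply: (@le_trans _ _ (einfs u N)); last by apply: ereal_sup_ubound; exists N.
by apply: le_ereal_inf_tmp => _ [n Nn <-]; exact: h.
Qed.

Definition set_par {R : Type} (C : R * R) (a : arm) (theta : R) : R * R :=
  match a with arm1 => (theta, C.2) | arm2 => (C.1, theta) end.

Lemma cvg_probability1 (R : realType) (d : measure_display) (T : measurableType d)
    (P : probability T R) (A : nat -> set T) :
  (forall t, measurable (A t)) ->
  (forall eta : R, 0 < eta -> \forall t \near \oo, (P (~` A t) <= eta%:E)%E) ->
  (fun t => P (A t)) @ \oo --> 1%E.
Proof.
move=> mA h; apply/fine_cvgP; split.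
  by apply: nearW => t; exact: fin_num_measure.
apply/cvgrPdist_le => eta eta0; have := h _ eta0.
apply: filterS => t /=; rewrite probability_setC//.
have := fin_num_measure P _ (mA t).
have := probability_le1 P (mA t).
case: (P (A t)) => //= p; rewrite !lee_fin => p1 _ hp.
by rewrite ger0_norm ?subr_ge0.
Qed.

(** No uniformity over alternatives is required: the limit in probability uses one alternative close
    to the infimum, and the liminf is bounded by each alternative in turn. *)
Theorem theorem7 (R : realType) (Theta : set R) (X : finType)
  (F : R -> X -> probability R R) (g : X -> R)
  (d : measure_display) (Omega : measurableType d)
  (P : R * R -> probability Omega R)
  (Xs : nat -> Omega -> X) (Y : arm -> nat -> Omega -> R)
  (phi : @rule R X) (C0 : R * R) (j : arm) :
  (* (a),(b): X finite with law g not depending on C, g x > 0 *)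
  (forall x, 0 < g x) -> \sum_(x in X) g x = 1 ->
  (* finite means *)
  (forall theta x, Theta theta ->
     (F theta x).-integrable [set: R] (fun y => y%:E)) ->
  (* (c) *)
  (forall theta vartheta x, Theta theta -> Theta vartheta -> theta <> vartheta ->
     (0 < KLcond F theta vartheta x)%E /\ (KLcond F theta vartheta x < +oo)%E) ->
  (* the model under every configuration C in Theta^2 *)
  (forall C : R * R, Theta C.1 -> Theta C.2 -> model F g (P C) C Xs Y) ->
  (* phi is a (measurable) uniformly good rule *)
  measurable_rule phi ->
  (forall C : R * R, Theta C.1 -> Theta C.2 -> forall alpha : R, 0 < alpha ->
     (fun t : nat => fine (\int[P C]_w ((Tinf F phi Xs Y C t w)%:R)%:E)%E
                       / (t%:R `^ alpha)) @ \oo --> 0) ->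
  (* C0 is a configuration in which arm j is preferred for every x *)
  Theta C0.1 -> Theta C0.2 ->
  (forall x, mean F (cfg_par C0 (other j)) x < mean F (cfg_par C0 j) x) ->
  ((0 < K_const F Theta C0 j)%E ->
   forall eps : R, 0 < eps ->
     (fun t : nat => P C0 [set w | (((1 - eps) * ln t%:R)%:E * (K_const F Theta C0 j)^-1
                               <= ((Tinf F phi Xs Y C0 t w)%:R)%:E)%E])
       @ \oo --> 1%E)
  /\
  ((K_const F Theta C0 j)^-1 <=
     limn_einf (fun t : nat =>
       (fine (\int[P C0]_w ((Tinf F phi Xs Y C0 t w)%:R)%:E)%E / ln t%:R)%:E))%E.
Proof.
move=> g0 g1 _ KLc modC mphi good T1 T2 pref.
set K := K_const F Theta C0 j.
set Alt := [set theta | Theta theta /\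
  exists x0, mean F (cfg_par C0 j) x0 < mean F theta x0].
have mod0 := modC C0 T1 T2.
have Tpar a : Theta (cfg_par C0 a) by case: a.
have TE t o : Tinf F phi Xs Y C0 t o = pulls Xs Y phi (other j) t o.
  exact: Tinf_pulls.
have mT t : measurable_fun setT (fun o => (Tinf F phi Xs Y C0 t o)%:R : R).
  by apply: (past_measurable_fun mod0 (t := t)); exact: past_measurable_Tinf.
have key theta : Alt theta -> exists k, [/\
    ereal_sup [set KLcond F (cfg_par C0 (other j)) theta x | x in [set: X]] = k%:E,
    0 < k & forall eps eta : R, 0 < eps < 1 -> 0 < eta -> \forall t \near \oo,
    (P C0 [set o | ((Tinf F phi Xs Y C0 t o)%:R < (1 - eps) / k * ln t%:R)%R]
       <= eta%:E)%E].
  move=> [Tth [x0 hx0]].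
  have neq : cfg_par C0 (other j) <> theta.
    by move=> E; have := lt_trans (pref x0) hx0; rewrite E ltxx.
  pose kl x := KLcond F (cfg_par C0 (other j)) theta x.
  have kl0 x : (0 < kl x)%E by have [] := KLc _ _ x (Tpar (other j)) Tth neq.
  have kloo x : (kl x < +oo)%E by have [] := KLc _ _ x (Tpar (other j)) Tth neq.
  set S := ereal_sup _.
  have Sub x : (kl x <= S)%E by apply: ereal_sup_ubound; exists x.
  have S0 : (0 < S)%E by exact: lt_le_trans (kl0 x0) (Sub x0).
  (* Over a finite [X] the supremum is at most the sum of the divergences. *)
  have Soo : (S < +oo)%E.
    apply: (@le_lt_trans _ _ (\sum_(x in X) fine (kl x))%:E); last exact: ltry.
    apply: ge_ereal_sup => _ [x _ <-].
    have klf : kl x \is a fin_num by rewrite ge0_fin_numE// ltW.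
    rewrite -/(kl x) -(fineK klf) lee_fin (bigD1 x)//= lerDl.
    by apply: sumr_ge0 => y _; rewrite fine_ge0// ltW.
  have Sf : S \is a fin_num by rewrite ge0_fin_numE// ltW.
  exists (fine S); split; first by rewrite fineK.
    by apply: fine_gt0; rewrite S0 Soo.
  move=> eps eta eps01 eta0.
  (* Only the inferior arm is changed, so [C'] stays in the class where the rule is uniformly good,
     and at [x0] the changed arm is strictly better. *)
  pose C' := set_par C0 (other j) theta.
  have pi : cfg_par C' (other j) = theta by rewrite /C'; case: (j).
  have pj : cfg_par C0 j = cfg_par C' j by rewrite /C'; case: (j).
  have TC1 : Theta C'.1 by rewrite /C'; case: (j).
  have TC2 : Theta C'.2 by rewrite /C'; case: (j).
  under eq_near do under eq_set do rewrite TE.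
  apply: (few_pulls_unlikely mod0 (modC C' TC1 TC2) g0 g1 mphi (x0 := x0)) => //.
  - by rewrite pi -pj.
  - by move=> x; rewrite pi; exact: kl0.
  - by move=> x; rewrite pi fineK//; exact: Sub.
  - by apply: fine_gt0; rewrite S0 Soo.
  - exact: good.
have lnt0 t : 0 <= ln t%:R :> R.
  by case: t => [|t]; [rewrite ln0|rewrite ln_ge0// ler1n].
have K0 : (0 <= K)%E.
  apply: le_ereal_inf_tmp => _ [theta At <-].
  by have [k [-> k0 _]] := key _ At; rewrite lee_fin ltW.
have KP : K = +oo%E \/ exists2 kap, 0 <= kap & K = kap%:E.
  move: K0; case: K => [kap|//|//] ?; [right; exists kap => //|by left].
split.
- move=> Kpos eps eps0; apply: cvg_probability1 => [t|eta eta0].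
    rewrite -[X in measurable X]setTI; apply: emeasurable_fun_le => //.
    exact/measurable_EFinP.
  (* In both cases the threshold is nonpositive, so the complementary event is empty. *)
  have triv : ((1 - eps <= 0)%R \/ K = +oo%E) -> \forall t \near \oo, (P C0 (~` [set w |
      (((1 - eps) * ln t%:R)%:E * K^-1 <= ((Tinf F phi Xs Y C0 t w)%:R)%:E)%E])
      <= eta%:E)%E.
    move=> h; apply: nearW => t; rewrite (_ : ~` _ = set0).
      by rewrite measure0 lee_fin ltW.
    apply/seteqP; split => // w /=; apply.
    apply: (@le_trans _ _ 0%E); last by rewrite lee_fin.
    case: h => [e1|->]; last by rewrite /inve mule0.
    apply: mule_le0_ge0; first by rewrite lee_fin mulr_le0_ge0.
    case: KP => [->|[kap kap0 ->]]; rewrite /inve//.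
    by case: ifP => // _; rewrite lee_fin invr_ge0.
  case: KP => [Koo|[kap _ KE]]; first by apply: triv; right.
  have [e1|e1] := leP 1 eps; first by apply: triv; left; rewrite subr_le0.
  have kap0 : 0 < kap by rewrite -lte_fin -KE.
  have e1' : 0 < 1 - eps by rewrite subr_gt0.
  (* An alternative below this level satisfies [(1 - eps) / kap <= (1 - eps / 2) / k], so [key] with
     [eps / 2] covers the event. *)
  have : (K < (kap * ((1 - eps / 2) / (1 - eps)))%:E)%E.
    rewrite KE lte_fin ltr_pMr// ltr_pdivlMr// mul1r; lra.
  case/ereal_inf_lt => _ [theta At <-]; have [k [-> k0 kP]] := key _ At.
  rewrite lte_fin => kkap.
  have eps2 : 0 < eps / 2 < 1 by apply/andP; split; lra.
  have := kP (eps / 2) eta eps2 eta0; apply: filterS => t.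
  apply: le_trans.
  apply: le_measure; rewrite ?inE.
  + apply: measurableC; rewrite -[X in measurable X]setTI; apply: emeasurable_fun_le => //.
    exact/measurable_EFinP.
  + exact: measurable_set_lt.
  move=> w /= /negP; rewrite -ltNge KE /inve gt_eqF// -EFinM lte_fin => /lt_le_trans; apply.
  rewrite mulrAC; apply: ler_wpM2r => //.
  rewrite ler_pdivrMr// mulrAC ler_pdivlMr//.
  move: (ltW kkap); rewrite mulrA ler_pdivlMr//; lra.
- set u := fun t : nat => _; set lim := limn_einf u.
  have u0 t : (0 <= u t)%E.
    rewrite /u lee_fin; apply: divr_ge0 => //; apply: fine_ge0.
    by apply: integral_ge0 => w _; rewrite lee_fin.
  have lim0 : (0 <= lim)%E by apply: le_limn_einf; exact: nearW.
  have limk theta k : Alt theta ->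
      ereal_sup [set KLcond F (cfg_par C0 (other j)) theta x | x in [set: X]] = k%:E ->
      0 < k /\ ((k^-1)%:E <= lim)%E.
    move=> At Sk; have [k' [Sk' k0 kP]] := key _ At.
    have kk' : k' = k by move: Sk'; rewrite Sk => -[].
    rewrite {k' Sk'}kk' in k0 kP; split => //.
    (* One factor [1 - e] comes from the pull threshold, the other from the probability of reaching
       it. *)
    have near_u e : 0 < e < 1 -> (((1 - e) * (1 - e) / k)%:E <= lim)%E.
      move=> e01; have /andP[e0 e1] := e01; apply: le_limn_einf.
      have := kP e e e01 e0; have := ln_nat_near (1 : R).
      apply: filterS2 => t ln1 Pe.
      have ln0 : 0 < ln t%:R :> R by exact: lt_le_trans ln1.
      set A := [set o | _] in Pe.
      have mA : measurable A by exact: measurable_set_lt.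
      have : (((1 - e) / k * ln t%:R)%:E * P C0 (~` A) <=
          \int[P C0]_w ((Tinf F phi Xs Y C0 t w)%:R)%:E)%E.
        apply: markov_set => //; first exact: measurableC.
          by rewrite mulr_ge0// divr_ge0 ?subr_ge0// ltW.
        by move=> o /negP; rewrite -leNgt.
      rewrite -[leRHS](fineK (integral_Tinf_fin_num (P C0) (mT t))) => M.
      rewrite /u lee_fin ler_pdivlMr//.
      rewrite -lee_fin; apply: le_trans M.
      rewrite (_ : _ * ln t%:R = (1 - e) / k * ln t%:R * (1 - e)); last by ring.
      rewrite [leLHS]EFinM; apply: lee_wpmul2l.
        by rewrite lee_fin mulr_ge0// divr_ge0 ?subr_ge0// ltW.
      by rewrite probability_setC// EFinB leeB.
    move: lim0 near_u; case: (lim) => [r| |] //; last by move=> *; exact: leey.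
    rewrite !lee_fin => r0 near_u; apply/ler_addgt0Pr => e e0.
    (* Since [(1 - f)^2 >= 1 - 2 * f], the bound [f <= e * k / 2] loses at most [e] from [1 / k]. *)
    pose f := Num.min (1 / 2) (e * k / 2).
    have f0 : 0 < f by rewrite lt_min !divr_gt0// mulr_gt0.
    have f1 : f <= 1 / 2 by rewrite ge_min lexx.
    have f2 : f <= e * k / 2 by rewrite ge_min lexx orbT.
    have f01 : 0 < f < 1 by rewrite f0; move: f1; lra.
    have := near_u f f01; rewrite lee_fin ler_pdivrMr// => h.
    rewrite -[leLHS]mul1r ler_pdivrMr// mulrDl.
    have : 0 <= f * f by rewrite mulr_ge0 ?ltW.
    by move: h f2; move: (r * k) (e * k) => rk ek; lra.
  case: KP => [Koo|[kap kap0 KE]].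
    by rewrite (_ : K^-1 = 0)%E// Koo.
  have /ereal_inf_lt[_ [theta At _] _] : (K < +oo)%E by rewrite KE ltry.
  have [k [Sk _ _]] := key _ At; have [k0 klim] := limk _ _ At Sk.
  move: klim limk {lim0}; case: (lim) => [r| |] //; last by move=> *; exact: leey.
  rewrite lee_fin => kr limr.
  have r0 : 0 < r by apply: lt_le_trans kr; rewrite invr_gt0.
  (* Inverting the bound for every alternative puts [r^-1] below the infimum. A real liminf thus
     forces [K > 0]; when [K = 0] only the case of an infinite liminf remains. *)
  have : ((r^-1)%:E <= K)%E.
    apply: le_ereal_inf_tmp => _ [theta' At' <-].
    have [k' [Sk' _ _]] := key _ At'; have [k0' kr'] := limr _ _ At' Sk'.
    by rewrite Sk' lee_fin -[leRHS]invrK lef_pV2 ?posrE ?invr_gt0.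
  rewrite KE lee_fin => rkap.
  have kap_gt0 : 0 < kap by apply: lt_le_trans rkap; rewrite invr_gt0.
  by rewrite /inve gt_eqF// lee_fin -[leRHS]invrK lef_pV2 ?posrE ?invr_gt0.
Qed.
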